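(* Let $d>1$ be an integer and let $X$ be an $\mathbb{R}^d$-valued random variable with decay rate $\lambda$ with constant $C_1$, projection Lipschitz constant $L_\pi$, and radial Lipschitz constant $L_\theta$. Let $(X_1,X_2,\ldots)$ be a sequence of i.i.d. random variables equal in distribution to $X$, and write $X^{(n)}=(X_1,\ldots,X_n)$. Let $C_2$ be the absolute spherical covering constant. Let $n\ge 1$ be an integer, fix $\varepsilon>0$ and suppose that $$\varepsilon (n+1)^{-1}\left(L_\theta+L_\pi \varepsilon\frac{2n^{3/2}}{\sqrt{\lambda}(n+1)}\right)^{-1}<\arccos(d^{-1/2})\quad\text{and}\quad 2\varepsilon n^{\frac{3}{2}}>\sqrt{\lambda}(n+1).$$ Then $$ \Pr\left(\sup_{q\in\mathbb{R}^d}|\operatorname{HD}(q;X)-\operatorname{HD}(q;X^{(n)})|\leq\varepsilon\right)\geq 1-(A+B)\,e^4e^{-2n\varepsilon^2}, $$ where $$ A=2C_2\left(\frac{(L_\theta\sqrt{\lambda}(n+1)+2 L_\pi n^{\frac{3}{2}}\varepsilon)\sqrt{d}}{\varepsilon\sqrt{\lambda}}\right)^{d-1} (d-1)^{\frac{3}{2}}\ln(d),\qquad B=C_1 \left(\frac{\varepsilon n}{\sqrt{\lambda}(n+1)}\right)^{3d-5}n^{\frac{3}{2}(d-1)}. $$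
   Context: Halfspace depth: for $q\in\mathbb{R}^d$, $\operatorname{HD}(q;X)=\min_{H}\Pr(X\in H)$ and $\operatorname{HD}(q;X^{(n)})=n^{-1}\min_{H}\#\{i\le n: X_i\in H\}$, where both minima are over all (closed) halfspaces $H$ of $\mathbb{R}^d$ containing $q$. For $\theta\in S^{d-1}$ (the unit sphere in $\mathbb{R}^d$), $u_\theta\in\mathbb{R}^d$ is the unit vector in direction $\theta$, $d_\theta(p)=\langle p,u_\theta\rangle$ for $p\in\mathbb{R}^d$, and $F_\theta(t)=\Pr(d_\theta(X)\le t)$ for $t\in\mathbb{R}$. For $\theta,\varphi\in S^{d-1}$, $|\theta-\varphi|$ denotes the spherical distance (the central angle between the two points). $X$ has decay rate $\lambda>0$ with constant $C_1>0$ if $\Pr(|X|>R)<C_1 R^{3d-5}e^{-\lambda R^2/2}$ for all $R>1$. $X$ has projection Lipschitz constant $L_\pi>0$ if for all $\theta\in S^{d-1}$ the function $t\mapsto F_\theta(t)$ is Lipschitz with constant $L_\pi$. $X$ has radial Lipschitz constant $L_\theta\ge 0$ (a single number, not depending on the direction, despite the subscript) if for every fixed $t\in\mathbb{R}$, $|F_\theta(t)-F_\varphi(t)|\le L_\theta|\theta-\varphi|$ for all $\theta,\varphi\in S^{d-1}$. Spherical covering constant: $C_2>0$ is an absolute constant (known to exist) such that for every integer $d>1$ and every $0<\psi<\arccos(d^{-1/2})$, the sphere $S^{d-1}$ can be covered by at most $C_2\left(\frac{\sqrt{d}}{\psi}\right)^{d-1}(d-1)^{3/2}\ln(d)$ spherical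 balls of radius $\psi$ (radius measured in spherical distance). *)

(* Defs.v *)
From HB Require Import structures.
From mathcomp Require Import all_boot all_order all_algebra.
From mathcomp Require Import all_classical all_reals all_analysis.

Set Implicit Arguments.
Unset Strict Implicit.
Unset Printing Implicit Defensive.

Import Order.TTheory GRing.Theory Num.Theory.
Import numFieldNormedType.Exports.

Local Open Scope classical_set_scope.
Local Open Scope ring_scope.

(* 'rV[R]_d with its Borel sigma-algebra. *)
Definition borelRd (R : realType) (d : nat) :=
  g_sigma_algebraType (@open 'rV[R]_d).

Definition dotprod (R : realType) (d : nat) (x y : 'rV[R]_d) : R :=
  \sum_(i < d) x ord0 i * y ord0 i.

(* The library norm on 'rV[R]_d is the sup norm, hence a separate definition. *)
Definition enorm (R : realType) (d : nat) (x : 'rV[R]_d) : R :=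
  Num.sqrt (dotprod x x).

(* S^(d-1); a direction theta is identified with its unit vector u_theta. *)
Definition sphere (R : realType) (d : nat) : set 'rV[R]_d :=
  [set u | enorm u = 1].

Definition sphdist (R : realType) (d : nat) (u v : 'rV[R]_d) : R :=
  acos (dotprod u v).

Definition closed_halfspace (R : realType) (d : nat) (H : set 'rV[R]_d) : Prop :=
  exists (u : 'rV[R]_d) (c : R), u != 0 /\ H = [set x | c <= dotprod x u].

Definition halfspaces_containing (R : realType) (d : nat) (q : 'rV[R]_d) :
    set (set 'rV[R]_d) :=
  [set H | closed_halfspace H /\ H q].

Section Distribution.
Context (R : realType) (d : nat) (dT : measure_display)
  (T : measurableType dT) (P : probability T R).

(* inf renders the minimum over halfspaces: the values are nonnegative reals and
   the family of halfspaces is nonempty for d > 0. *)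
Definition HD (X : T -> 'rV[R]_d) (q : 'rV[R]_d) : R :=
  inf [set fine (P (X @^-1` H)) | H in halfspaces_containing q].

Definition projection_cdf (X : T -> 'rV[R]_d) (theta : 'rV[R]_d) (t : R) : R :=
  fine (P [set w | dotprod (X w) theta <= t]).

(* The exponent 3 * d - 5 is a true subtraction for d > 1. *)
Definition decay_rate (X : T -> 'rV[R]_d) (lambda C1 : R) : Prop :=
  [/\ 0 < lambda, 0 < C1 &
    forall r : R, 1 < r ->
      (P [set w | (r < enorm (X w))%R] <
        (C1 * r ^+ (3 * d - 5) * expR (- (lambda * r ^+ 2 / 2)))%:E)%E].

Definition projection_lipschitz (X : T -> 'rV[R]_d) (L : R) : Prop :=
  0 < L /\
  forall theta, sphere theta -> forall s t : R,
    `|projection_cdf X theta s - projection_cdf X theta t| <= L * `|s - t|.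

Definition radial_lipschitz (X : T -> 'rV[R]_d) (L : R) : Prop :=
  0 <= L /\
  forall (t : R) theta phi, sphere theta -> sphere phi ->
    `|projection_cdf X theta t - projection_cdf X phi t| <=
      L * sphdist theta phi.

Definition same_distribution (X Y : {RV P >-> borelRd R d}) : Prop :=
  forall B : set (borelRd R d), measurable B ->
    distribution P X B = distribution P Y B.

Definition independent_seq (Xs : nat -> {RV P >-> borelRd R d}) : Prop :=
  forall (J : seq nat) (B : nat -> set (borelRd R d)), uniq J ->
    (forall j, measurable (B j)) ->
    P (\bigcap_(j in [set` J]) (Xs j @^-1` B j)) =
      (\prod_(j <- J) P (Xs j @^-1` B j))%E.

End Distribution.

Definition HD_sample (R : realType) (d n : nat) (x : 'I_n -> 'rV[R]_d)
    (q : 'rV[R]_d) : R :=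
  n%:R^-1 *
  inf [set #|[pred i : 'I_n | `[< H (x i) >]]|%:R | H in halfspaces_containing q].

(* Centers lie on the sphere and balls are closed. *)
Definition spherical_covering_constant (R : realType) (C2 : R) : Prop :=
  0 < C2 /\
  forall (d : nat) (psi : R), (1 < d)%N ->
    0 < psi -> psi < acos (Num.sqrt d%:R)^-1 ->
    exists s : seq 'rV[R]_d,
      [/\ forall c, c \in s -> sphere c,
          (size s)%:R <= C2 * (Num.sqrt d%:R / psi) ^+ (d - 1) *
                         (d - 1)%:R `^ (3 / 2) * ln d%:R &
          forall theta, sphere theta ->
            exists2 c, c \in s & sphdist c theta <= psi].

(* Main.v *)
Require Import Defs.
From HB Require Import structures.
From mathcomp Require Import all_boot all_order all_algebra.
From mathcomp Require Import all_classical all_reals all_analysis.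
From mathcomp Require Import ring lra zify.
Import Order.TTheory GRing.Theory Num.Theory.
Import numFieldNormedType.Exports.
Local Open Scope classical_set_scope.
Local Open Scope ring_scope.

(** Every closed halfspace is [{x | <x, theta> <= t}] for a unit vector [theta], so both
    depths are infima of values of one-dimensional distribution functions, true ones for
    the population depth and empirical ones for the sample depth.  If the two families differ by at most [eps] for all [theta] and
    [t], so do the depths at every point ([HD_deviation_le]).

    Two ingredients give this uniformity.  For one direction it is a
    Dvoretzky-Kiefer-Wolfowitz inequality ([dkw_projection]).  For all directions at
    once, the sphere is covered by balls of radius [psi]; when the sample lies in the
    ball of radius [r], turning [theta] to the nearest centre moves every projection
    by at most [psi * r], which the two Lipschitz constants convert into an error
    [psi * (Ltheta + Lpi * r)] ([direction_transfer]).  A union bound over the centres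
    and over the sample points gives [depth_deviation].

    The inequality for one direction is proved with the constant 4, by counting.  The
    distribution function of a projection is continuous, so the line splits into [M]
    cells of probability [1 / M], and the sample becomes a uniform word
    [f : 'I_n -> 'I_M].  Fix a level [k] and give each letter below [k] the weight
    [y], the other letters a common weight, with average weight 1.  The product of
    these weights along the word is the likelihood ratio of a tilted law, it depends
    only on the number of letters below [k], and as [k] grows it is a martingale;
    hence it exceeds [exp (2 n e^2)] at some level with probability at most
    [exp (- 2 n e^2)] ([first_crossing_bound], a form of Ville's inequality).
    The weight [(1 + e) / (1 - e)] detects an excess of letters at levels below the
    middle.  An excess above the middle is, in the mirrored word, a deficit at levels
    below the middle; it is detected by [(1 - h) / (1 + h)] with [h = e + e^2 / 3].
    That the ratio at a crossing does reach [exp (2 n e^2)] is the content of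
    [tilt_up_ineq] and [tilt_down_ineq].

    The constants are met as follows.  Let [R0 = 2 eps n^(3/2) / (sqrt lambda (n + 1))]
    and [psi = eps / (n + 1) / (Ltheta + Lpi R0)], so that [A] is twice the bound on
    the size of the covering.  The sample radius is [r = 5 eps sqrt (n / lambda)], which
    is [(5/2) ((n + 1) / n) R0]: at radius [R0] itself the tail would carry a factor
    [2^(3d - 5)] that is absent from [B], whereas at radius [r] the tail has the
    exponent [- (25/2) n eps^2], far below [- 2 n eps^2].  The net then costs
    [(5/2) eps / n] in the deviation, which the factor [e^4] pays for
    ([expR_budget]), and the surplus in the tail exponent absorbs
    [(5 (n + 1) / n)^(3d - 5)] ([tail_constant]).  The first of these needs
    [eps <= 4/7], the second [n >= 7] and a lower bound on [n eps^2] in terms of [d].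
    These come from excluding two cases.  Population depth is at most 1/2 and sample depth
    almost surely at most [1/2 + 1 / (2n)], which settles all [eps] above the latter
    ([depth_half]).  If the right-hand side is nonpositive the claim is void; otherwise
    [2 n eps^2 > 4 + ln A], and [A] is bounded below because a covering of the circle has
    at least one ball, which bounds [C2] below.  Together the two restrictions on [eps]
    give [n >= 7] and [eps <= 4/7] ([sample_size_ge7]).

    Finally, the deviation event is measurable: population depth is continuous, so
    that a sample depth below it by more than [eps] is visible at rational
    points and directions ([depth_below_rational]), and a sample depth above it is a
    compactness statement over rational approximations ([depth_above_compact]). *)

Set Implicit Arguments.
Unset Strict Implicit.
Unset Printing Implicit Defensive.

(** * The logarithmic exponents of two tilted laws *)

Lemma ge0_derive_le (R : realType) (f f' : R -> R) (a b : R) :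
  (forall x, a <= x <= b -> is_derive x 1 f (f' x)) ->
  (forall x, a <= x <= b -> 0 <= f' x) ->
  a <= b -> f a <= f b.
Proof.
move=> fd f'0 ab.
have cf x : a <= x <= b -> {for x, continuous f}.
  move=> /fd [dfx _]; exact/differentiable_continuous/derivable1_diffP.
apply: (@ger0_derive1_le_cc _ f a b) => //; rewrite ?in_itv /= ?lexx ?ab //.
- move=> x; rewrite in_itv /= => /andP[ax xb].
  by have [] := fd x; rewrite ?(ltW ax) ?(ltW xb).
- move=> x; rewrite in_itv /= => /andP[ax xb].
  have xab : a <= x <= b by rewrite (ltW ax) (ltW xb).
  by have [_ e] := fd x xab; rewrite derive1E e f'0.
- apply: continuous_in_subspaceT => x; rewrite inE /= in_itv /= => xab.
  exact: cf.
Qed.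

(** Twice the inverse hyperbolic tangent. *)
Definition lnratio (R : realType) (x : R) : R := ln (1 + x) - ln (1 - x).

Lemma lnratioE (R : realType) (x : R) : -1 < x < 1 ->
  ln ((1 + x) / (1 - x)) = lnratio x.
Proof. by move=> /andP[x1 x2]; rewrite ln_div // posrE; lra. Qed.

Lemma is_derive_lnratio (R : realType) (c x : R) : -1 < c * x < 1 ->
  is_derive x 1 (fun x => lnratio (c * x)) (2 * c / (1 - (c * x) ^+ 2)).
Proof.
move=> /andP[cx1 cx2].
have lin (e : R) : is_derive x 1 (fun x : R => 1 + e * x) e.
  apply: is_derive_eq; rewrite /GRing.scale /=; ring.
have d1 : is_derive x 1 (fun x => ln (1 + c * x)) (c * (1 + c * x)^-1).
  rewrite mulrC.
  have l : 0 < 1 + c * x by lra.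
  exact: (@is_derive1_comp _ (@ln R) (fun x => 1 + c * x) _ _ _ (is_derive1_ln l) (lin c)).
have d2 : is_derive x 1 (fun x => ln (1 - c * x)) (- c * (1 + - c * x)^-1).
  rewrite mulrC.
  have l : 0 < 1 + - c * x by lra.
  rewrite (_ : (fun x => ln (1 - c * x)) = @ln R \o (fun x => 1 + - c * x)); last first.
    by apply/funext => z /=; rewrite mulNr.
  exact: (@is_derive1_comp _ (@ln R) (fun x => 1 + - c * x) _ _ _ (is_derive1_ln l) (lin (- c))).
rewrite /lnratio; apply: is_derive_eq; field.
by apply/andP; split; [|apply/andP; split]; apply/eqP; nra.
Qed.

Lemma lnratio0 (R : realType) : lnratio (0 : R) = 0.
Proof. by rewrite /lnratio addr0 subr0 subrr. Qed.

(** The function is convex on [0, 1[ and vanishes at 0. *)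
Lemma lnratio_star (R : realType) (s x : R) : 0 <= s <= 1 -> 0 <= x < 1 ->
  lnratio (s * x) <= s * lnratio x.
Proof.
move=> /andP[s0 s1] /andP[x0 x1]; rewrite -subr_ge0.
pose f (z : R) : R := s * lnratio (1 * z) - lnratio (s * z).
suff : f 0 <= f x by rewrite /f !mulr0 lnratio0 mul1r mulr0 subrr.
apply: (@ge0_derive_le _ f (fun z => s * (2 * 1 / (1 - (1 * z) ^+ 2))
    - 2 * s / (1 - (s * z) ^+ 2))); [move=> z /andP[z0 zx]|move=> z /andP[z0 zx]|by []].
  have /andP[sz0 szz] : 0 <= s * z <= z by rewrite mulr_ge0 //= ler_piMl.
  apply: is_deriveB; last by apply: is_derive_lnratio; lra.
  by apply: is_deriveZ; apply: is_derive_lnratio; lra.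
have z1 : 0 < 1 - (1 * z) ^+ 2 by nra.
have /andP[sz0 szz] : 0 <= s * z <= z by rewrite mulr_ge0 //= ler_piMl.
have szl : (s * z) ^+ 2 <= (1 * z) ^+ 2 by rewrite mul1r ler_sqr ?nnegrE.
have sz1 : 0 < 1 - (s * z) ^+ 2 by lra.
have -> : s * (2 * 1 / (1 - (1 * z) ^+ 2)) - 2 * s / (1 - (s * z) ^+ 2)
    = 2 * s * ((1 - (1 * z) ^+ 2)^-1 - (1 - (s * z) ^+ 2)^-1) by ring.
rewrite mulr_ge0 ?mulr_ge0 // subr_ge0 lef_pV2 ?posrE //; lra.
Qed.

Lemma lnratio_ge (R : realType) (x : R) : 0 <= x < 1 ->
  2 * x + 2 / 3 * x ^+ 3 <= lnratio x.
Proof.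
move=> /andP[x0 x1]; rewrite -subr_ge0.
pose f (z : R) : R := lnratio (1 * z) - (2 * z + 2 / 3 * z ^+ 3).
suff : f 0 <= f x.
  by rewrite /f !mulr0 lnratio0 mul1r expr0n /= mulr0 addr0 subrr.
apply: (@ge0_derive_le _ f (fun z => 2 * 1 / (1 - (1 * z) ^+ 2)
    - (2 + 2 * z ^+ 2))); [move=> z /andP[z0 zx]|move=> z /andP[z0 zx]|by []].
  apply: is_deriveB; first by apply: is_derive_lnratio; lra.
  by apply: is_derive_eq; rewrite /GRing.scale /=; field.
have z1 : 0 < 1 - z ^+ 2 by nra.
rewrite mul1r mulr1 subr_ge0 ler_pdivlMr //; nra.
Qed.

Lemma lnratio_le (R : realType) (x C : R) : 0 <= x < 1 ->
  2 <= 5 * C * (1 - x ^+ 2) ->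
  lnratio x <= 2 * x + 2 / 3 * x ^+ 3 + C * x ^+ 5.
Proof.
move=> /andP[x0 x1] Cx; rewrite -subr_ge0.
pose f (z : R) : R := (2 * z + 2 / 3 * z ^+ 3 + C * z ^+ 5) - lnratio (1 * z).
suff : f 0 <= f x.
  by rewrite /f !mulr0 lnratio0 mul1r !expr0n /= !mulr0 !addr0 subrr.
apply: (@ge0_derive_le _ f (fun z => (2 + 2 * z ^+ 2 + 5 * C * z ^+ 4)
    - 2 * 1 / (1 - (1 * z) ^+ 2))); [move=> z /andP[z0 zx]|move=> z /andP[z0 zx]|by []].
  apply: is_deriveB; last by apply: is_derive_lnratio; lra.
  by apply: is_derive_eq; rewrite /GRing.scale /=; field.
have z1 : 0 < 1 - z ^+ 2 by nra.
rewrite mul1r mulr1 subr_ge0 ler_pdivrMr //.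
have C0 : 0 <= C.
  have x2 : 0 < 1 - x ^+ 2 by nra.
  rewrite leNgt; apply/negP => C0; nra.
have zx2 : z ^+ 2 <= x ^+ 2 by rewrite ler_sqr ?nnegrE.
have h : 2 <= 5 * C * (1 - z ^+ 2).
  by apply: le_trans Cx _; apply: ler_wpM2l; [apply: mulr_ge0|lra].
have := mulr_ge0 (exprn_ge0 4 z0) (_ : 0 <= 5 * C * (1 - z ^+ 2) - 2).
rewrite subr_ge0 => /(_ h) ?; nra.
Qed.

Lemma ln_le_sub1 (R : realType) (x : R) : 0 < x -> ln x <= x - 1.
Proof. by move=> x0; rewrite -{1}(subrKC 1 x); apply: le_ln1Dx; lra. Qed.

(** Exponent per letter at an upward crossing of level [t] in the left half.  With
    [s = t / (1 - t - e)] the second logarithm is [- lnratio (s * e)], which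
    star-shapedness bounds by [s * lnratio e]; what is left of the first logarithm is
    [e * lnratio e >= 2 * e ^+ 2]. *)
Lemma tilt_up_ineq (R : realType) (e t : R) : 0 < e < 1 ->
  0 <= t -> 2 * t <= 1 - e ->
  2 * e ^+ 2 <= (t + e) * ln ((1 + e) / (1 - e))
    + (1 - t - e) * ln ((1 - (1 + e) / (1 - e) * t) / (1 - t)).
Proof.
move=> /andP[e0 e1] t0 te.
have u0 : 0 < 1 - t - e by lra.
set s := t / (1 - t - e).
have s0 : 0 <= s by rewrite divr_ge0 // ltW.
have s1 : s <= 1 by rewrite ler_pdivrMr //; lra.
have us : (1 - t - e) * s = t by rewrite mulrC divfK // gt_eqF.
have se : 0 <= s * e < 1 by apply/andP; split; nra.
have -> : (1 - (1 + e) / (1 - e) * t) / (1 - t) = (1 - s * e) / (1 + s * e).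
  rewrite /s; field; apply/and4P; split; apply/eqP; nra.
have -> : ln ((1 - s * e) / (1 + s * e)) = - lnratio (s * e).
  by rewrite /lnratio ln_div ?posrE; [lra | lra | lra].
rewrite lnratioE; last by lra.
have A1 : lnratio (s * e) <= s * lnratio e.
  by apply: lnratio_star; apply/andP; split => //; apply: ltW.
have A2 : 2 * e + 2 / 3 * e ^+ 3 <= lnratio e.
  by apply: lnratio_ge; rewrite (ltW e0).
have e3 : 0 <= e ^+ 3 by apply: exprn_ge0; apply: ltW.
have h1 : (1 - t - e) * lnratio (s * e) <= t * lnratio e.
  have -> : t * lnratio e = (1 - t - e) * (s * lnratio e) by rewrite mulrA us.
  by rewrite ler_pM2l.
have h2 : e * (2 * e + 2 / 3 * e ^+ 3) <= e * lnratio e by rewrite ler_pM2l.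
have h3 : 0 <= e * e ^+ 3 by rewrite mulr_ge0 // ltW.
lra.
Qed.

(** What remains of [tilt_down_ineq] after Taylor bounds on the logarithms and division
    by [(2 / 3) * e ^+ 3], in the variable [x = 1 - s / (1 - s + h)]. *)
Lemma tilt_down_poly (R : realType) (e x : R) : 0 < e -> 7 * e <= 4 ->
  0 <= x <= 1 ->
  0 <= 1 - (1 + e / 3) * (1 - x)
     + (1 + e / 3) ^+ 3 * ((1 + e * (1 + e / 3)) * ((1 - x) ^+ 2 - (1 - x))
                     - e ^+ 2 / 3 * (1 - x) ^+ 3 + e)
     - 27 / 10 * e ^+ 2 * ((1 + 12 / 10 * e) * (2 - x) / 4 - e).
Proof.
move=> e0 e47 /andP[x0 x1].
set h := e * (1 + e / 3).
set g := 1 + e / 3.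
have ek k : e ^+ k.+1 <= 4 / 7 * e ^+ k.
  by rewrite exprS ler_wpM2r ?exprn_ge0 //; lra.
(* To first order g ^+ 3 * (1 + h) is 1 + 2 e; 13/4 accounts for e up to 4/7. *)
have gh : g ^+ 3 * (1 + h) <= 1 + 13 / 4 * e.
  have := ek 1%N; have := ek 2%N; have := ek 3%N; have := ek 4%N; rewrite /g /h; lra.
have g3 : 1 + e <= g ^+ 3 by rewrite /g; nra.
have x3 : (1 - x) ^+ 3 <= 1 - x by rewrite exprS ler_piMr ?exprn_ile1 ?subr_ge0 //; lra.
have xx : 0 <= x * (1 - x) by rewrite mulr_ge0 // subr_ge0.
have P : 0 <= x ^+ 2 - 13 / 4 * e * (x * (1 - x)) + e * ((1 + e) * (1 - e / 3 * (1 - x))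
   - (1 - x) / 3 - 27 / 10 * e * ((1 + 12 / 10 * e) * (2 - x) / 4 - e)).
  (* The left side is this quadratic in x plus a nonnegative multiple of e ^+ 3 * x. *)
  pose a := 1 + 13 / 4 * e.
  pose b := - (35 / 12 - 121 / 120 * e) * e.
  pose c := e * (2 / 3 - 41 / 60 * e + 56 / 75 * e ^+ 2).
  have a0 : 0 < 4 * a by rewrite /a; lra.
  have D : 0 <= 4 * a * c - b ^+ 2.
    have -> : 4 * a * c - b ^+ 2 = e * (4 * a * (2 / 3 - 41 / 60 * e + 56 / 75 * e ^+ 2)
      - e * (35 / 12 - 121 / 120 * e) ^+ 2) by rewrite /a /b /c; ring.
    apply: mulr_ge0; first by lra.
    have e3 : 0 <= e ^+ 3 by rewrite exprn_ge0 // ltW.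
    by have := ek 1%N; rewrite /a; lra.
  have Q : 0 <= a * x ^+ 2 + b * x + c.
    rewrite -(pmulr_rge0 _ a0).
    have -> : 4 * a * (a * x ^+ 2 + b * x + c) = (2 * a * x + b) ^+ 2 + (4 * a * c - b ^+ 2).
      by ring.
    by rewrite addr_ge0 ?sqr_ge0.
  have e2x : 0 <= e * e ^+ 2 * x by rewrite !mulr_ge0 ?exprn_ge0 // ltW.
  by move: Q; rewrite /a /b /c; lra.
have h1 : g ^+ 3 * (1 + h) * (x * (1 - x)) <= (1 + 13 / 4 * e) * (x * (1 - x)).
  by rewrite ler_wpM2r.
have h2 : (1 + e) * (e - e ^+ 2 / 3 * (1 - x)) <= g ^+ 3 * (e - e ^+ 2 / 3 * (1 - x) ^+ 3).
  apply: ler_pM => //; first by lra.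
    nra.
  by rewrite lerD2l lerN2 ler_wpM2l //; nra.
have -> : 1 - g * (1 - x) = x - e / 3 * (1 - x) by rewrite /g; ring.
clearbody g h.
lra.
Qed.

(** Exponent per letter at a downward crossing of level [s] in the left half.  With
    [h = e + k e^2], the excess over [2 e^2] is [(2/3) e^3 (1 - q) (3 k - q)] to leading
    order, where [q = s / (1 - s)].  As [s] crosses 1/2 the factor [1 - q] changes sign,
    which forces [k = 1/3]; the leading term is then a square that vanishes at the
    middle, where the margin is only of order [e^4]. *)
Lemma tilt_down_ineq (R : realType) (e s h v : R) : 0 < e -> 7 * e <= 4 ->
  e <= s -> 2 * s <= 1 + e ->
  h = e * (1 + e / 3) -> v = (1 - h) / (1 + h) ->
  2 * e ^+ 2 <= (s - e) * ln v + (1 - s + e) * ln ((1 - v * s) / (1 - s)).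
Proof.
move=> e0 e47 es se hE vE.
have h0 : 0 < h by rewrite hE mulr_gt0 //; lra.
have g65 : 1 + e / 3 <= 6 / 5 by lra.
have h1 : h <= 69 / 100 by rewrite hE; nra.
have w0 : 0 < 1 - s + h by lra.
(* (1 - v s) / (1 - s) = (1 + h r) / (1 - h r): both logarithms become values of lnratio. *)
set r := s / (1 - s + h).
have r0 : 0 <= r by rewrite divr_ge0 //; lra.
have r1 : r <= 1 by rewrite ler_pdivrMr // mul1r hE; nra.
have wr : (1 - s + h) * r = s by rewrite mulrC divfK // gt_eqF.
have hr : 0 <= h * r < 1 by apply/andP; split; nra.
have -> : (1 - v * s) / (1 - s) = (1 + h * r) / (1 - h * r).
  by rewrite vE /r; field; apply/and4P; split; apply/eqP; nra.
have -> : ln v = - lnratio h.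
  by rewrite vE /lnratio ln_div ?posrE; [lra | lra | lra].
rewrite lnratioE; last by lra.
have A1 := lnratio_ge hr.
have A2 : lnratio h <= 2 * h + 2 / 3 * h ^+ 3 + 3 / 4 * h ^+ 5.
  by apply: lnratio_le; [lra|nra].
have u0 : 0 <= 1 - s + e by lra.
have B1 := ler_wpM2l u0 A1.
have s0 : 0 <= s - e by lra.
have B2 := ler_wpM2l s0 A2.
suff : 0 <= (1 - s + e) * (2 * (h * r) + 2 / 3 * (h * r) ^+ 3)
  - (s - e) * (2 * h + 2 / 3 * h ^+ 3 + 3 / 4 * h ^+ 5) - 2 * e ^+ 2 by lra.
pose g := 1 + e / 3.
have -> : (1 - s + e) * (2 * (h * r) + 2 / 3 * (h * r) ^+ 3)
  - (s - e) * (2 * h + 2 / 3 * h ^+ 3 + 3 / 4 * h ^+ 5) - 2 * e ^+ 2 =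
  2 / 3 * e ^+ 3 * (1 - g * r + g ^+ 3 * ((1 + h) * (r ^+ 2 - r)
     - e ^+ 2 / 3 * r ^+ 3 + e) - 9 / 8 * g ^+ 5 * e ^+ 2 * (s - e)).
  by rewrite /r hE /g; field; apply/eqP; nra.
rewrite mulr_ge0 //; first by rewrite mulr_ge0 ?exprn_ge0 //; lra.
have x01 : 0 <= 1 - r <= 1 by lra.
have := tilt_down_poly e0 e47 x01; rewrite -/g -hE.
have -> : 1 - (1 - r) = r by lra.
have -> : 2 - (1 - r) = 1 + r by lra.
have g5 : 9 / 8 * g ^+ 5 <= 27 / 10.
  have gk : g ^+ 5 <= (25 / 21) ^+ 5.
    by rewrite lerXn2r ?nnegrE /g; lra.
  lra.
have sr : s = r * (1 + h) / (1 + r).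
  by rewrite /r; field; apply/andP; split; apply/eqP; lra.
have rr : r / (1 + r) <= (1 + r) / 4 by rewrite ler_pdivrMr; [nra|lra].
have s1 : s - e <= (1 + 12 / 10 * e) * (1 + r) / 4 - e.
  have -> : s = (1 + h) * (r / (1 + r)) by rewrite {1}sr; ring.
  rewrite lerD2r -[leRHS]mulrA; apply: ler_pM => //; first by lra.
    by rewrite divr_ge0 //; lra.
  by rewrite hE; nra.
have e2 : 0 <= e ^+ 2 by rewrite sqr_ge0.
have g50 : 0 <= g ^+ 5 by rewrite exprn_ge0 // /g; lra.
have : 9 / 8 * g ^+ 5 * e ^+ 2 * (s - e) <=
  27 / 10 * e ^+ 2 * ((1 + 12 / 10 * e) * (1 + r) / 4 - e).
  apply: ler_pM s0 _ s1; last by rewrite ler_wpM2r.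
  by apply: mulr_ge0 e2; lra.
lra.
Qed.

(** * First crossings of uniform words *)

Section FirstCrossing.
Variables (R : realFieldType) (n M : nat).
Implicit Types f : {ffun 'I_n -> 'I_M}.

(** For a word that encodes a sample, the empirical distribution function times [n]. *)
Definition below f (k : nat) : nat := #|[pred i | (f i < k)%N]|.

(** Density, relative to the uniform law on ['I_M], of the law that multiplies the
    letters below [k] by [y] and keeps the remaining ones equally likely. *)
Definition tilt (y : R) (k c : nat) : R :=
  if (c < k)%N then y else (M%:R - y * k%:R) / (M%:R - k%:R).

Lemma sum_tilt_below (y : R) (k K : nat) : (k <= K)%N -> (K < M)%N ->
  \sum_(c < M | (c < k)%N) tilt y K c = y * k%:R.
Proof.
move=> kK KM; rewrite -(big_ord_widen M (fun x : nat => tilt y K x)); last lia.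
rewrite (eq_bigr (fun=> y)); first by rewrite sumr_const card_ord mulr_natr.
by move=> i _; rewrite /tilt (leq_trans (ltn_ord i)).
Qed.

Lemma sum_tilt (y : R) (K : nat) : (K < M)%N ->
  \sum_(c < M) tilt y K c = M%:R.
Proof.
move=> KM; rewrite (bigID (fun c : 'I_M => (c < K)%N)) /= sum_tilt_below //.
rewrite (eq_bigr (fun=> (M%:R - y * K%:R) / (M%:R - K%:R))); last first.
  by move=> i /negbTE iK; rewrite /tilt iK.
have MK : (M%:R - K%:R : R) != 0 by rewrite subr_eq0 eqr_nat; lia.
rewrite sumr_const.
have -> : #|[pred i : 'I_M | ~~ (i < K)%N]| = (M - K)%N.
  have := cardC [pred i : 'I_M | (i < K)%N]; rewrite card_ord.
  have -> : #|[pred i : 'I_M | (i < K)%N]| = K.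
    by rewrite -sum1_card -(big_ord_widen M (fun=> 1%N)) ?sum1_card ?card_ord //; lia.
  move=> KC; rewrite (eq_card (_ : _ =i predC [pred i : 'I_M | (i < K)%N])).
    by rewrite -[X in (X - _)%N]KC addKn.
  by move=> i; rewrite !inE.
rewrite -[X in _ + X = _]mulr_natr natrB; last lia.
by field.
Qed.

Lemma sum_tilt_above (y : R) (k K : nat) : (k <= K)%N -> (K < M)%N ->
  \sum_(c < M | (k <= c)%N) tilt y K c = M%:R - y * k%:R.
Proof.
move=> kK KM; rewrite -(sum_tilt y KM) [in RHS](bigID (fun c : 'I_M => (c < k)%N)) /=.
rewrite sum_tilt_below // [RHS]addrAC subrr add0r.
by apply: eq_bigl => i; rewrite leqNgt.
Qed.

Lemma below_le f k : (below f k <= n)%N.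
Proof. by rewrite -[leqRHS]card_ord max_card. Qed.

Definition clip (k c : 'I_M) : 'I_M := if (c < k)%N then c else k.

Lemma below_clip f (k : 'I_M) (j : nat) : (j <= k)%N ->
  below [ffun i => clip k (f i)] j = below f j.
Proof.
move=> jk; apply: eq_card => i; rewrite !inE ffunE /clip.
by case: ifP => // /negbT; rewrite -leqNgt; lia.
Qed.

(** A clipped letter tells the letters below [k] apart and merges the others, and all
    laws tilted at a level [K >= k] give the merged letters the same total mass. *)
Lemma sum_tilt_clip (y : R) (k K : 'I_M) (a : 'I_M) : (k <= K)%N ->
  \sum_(c < M | clip k c == a) tilt y k c = \sum_(c < M | clip k c == a) tilt y K c.
Proof.
move=> kK; have [ak|ka] := ltnP a k.
  apply: eq_bigr => c /eqP; rewrite /clip /tilt; case: ifP => [ck _|_ ka].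
    by rewrite (leq_trans ck kK).
  by move: ak; rewrite -ka ltnn.
have [->|nak] := eqVneq a k; last first.
  have none c : (clip k c == a) = false.
    apply/negbTE; rewrite /clip; case: ifP => [ck|_]; last by rewrite eq_sym.
    by apply/eqP => ca; move: ck; rewrite ca ltnNge ka.
  by rewrite !big_pred0.
have ek : (fun c => clip k c == k) =1 (fun c : 'I_M => (k <= c)%N).
  move=> b; rewrite /clip; case: ltnP => [bk|_]; last by rewrite eqxx.
  by apply/eqP => ba; move: bk; rewrite ba ltnn.
have es (w : nat -> R) : \sum_(c < M | clip k c == k) w c = \sum_(c < M | (k <= c)%N) w c.
  exact: eq_bigl.
by rewrite !es !sum_tilt_above.
Qed.

(** The martingale property: on an event that only looks at the letters below [k], the
    tilts at levels [k] and [K >= k] have the same mass. *)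
Lemma sum_tilt_swap (y : R) (k K : 'I_M) (A : pred {ffun 'I_n -> 'I_M}) :
  (k <= K)%N -> (forall f, A [ffun i => clip k (f i)] = A f) ->
  \sum_(f | A f) \prod_i tilt y k (f i) = \sum_(f | A f) \prod_i tilt y K (f i).
Proof.
move=> kK Ak; pose tr f : {ffun 'I_n -> 'I_M} := [ffun i => clip k (f i)].
rewrite (partition_big tr xpredT) //= [RHS](partition_big tr xpredT) //=.
apply: eq_bigr => h _; case Ah : (A h); last first.
  have none f : A f && (tr f == h) = false.
    by apply/negbTE/negP => /andP[+ /eqP fh]; rewrite -Ak -/(tr f) fh Ah.
  by rewrite !big_pred0.
have fam : (fun f => A f && (tr f == h)) =1
    (fun f => f \in family (fun i c => clip k c == h i)).
  move=> f; apply/andP/familyP => [[_ /eqP fh] i|fh].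
    by rewrite unfold_in -fh ffunE.
  have trh : tr f = h by apply/ffunP => i; rewrite ffunE; apply/eqP; exact: fh.
  by rewrite -(Ak f) -/(tr f) trh Ah.
have es (w : nat -> R) : \sum_(f | A f && (tr f == h)) \prod_i w (f i) =
    \prod_i \sum_(c | clip k c == h i) w c.
  by rewrite (eq_bigl _ _ fam) (bigA_distr_big_dep (fun i c => clip k c == h i)).
rewrite !es.
by apply: eq_bigr => i _; apply: sum_tilt_clip.
Qed.

(** Ville's inequality for the likelihood ratios of the tilted laws.  Words are split by
    the first admissible level at which they cross; there the ratio is at least [E],
    and, crossing being decided by the letters below that level, it may be replaced by
    the ratio at the last admissible level, whose total over all words is [M ^ n]. *)
Lemma first_crossing_bound (S : pred nat) (Q : nat -> nat -> bool) (y E : R) :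
  0 <= y -> (forall k, S k -> (k < M)%N && (y * k%:R <= M%:R)) ->
  (forall k N, S k -> (N <= n)%N -> Q k N ->
    E <= y ^+ N * ((M%:R - y * k%:R) / (M%:R - k%:R)) ^+ (n - N)) ->
  E * #|[pred f : {ffun 'I_n -> 'I_M} | [exists k : 'I_M, S k && Q k (below f k)]]|%:R <= M%:R ^+ n.
Proof.
move=> y0 SM SQ.
have [k0 Sk0|none] := pickP [pred k : 'I_M | S k]; last first.
  rewrite eq_card0; first by rewrite mulr0 exprn_ge0.
  move=> f; rewrite !inE; apply/existsP => -[k /andP[Sk _]].
  by have := none k; rewrite /= Sk.
(* K is the last admissible level, to which all tilts are compared. *)
case: (arg_maxnP (fun k : 'I_M => k : nat) Sk0) => K /= SK Kmax.
have tilt0 (k : 'I_M) c : S k -> 0 <= tilt y k c.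
  move=> /SM /andP[kM yk]; rewrite /tilt; case: ifP => // _.
  by rewrite divr_ge0 // subr_ge0 // ler_nat ltnW.
pose hit f k := S k && Q k (below f k).
pose A (k : 'I_M) f := hit f k && [forall j : 'I_M, (j < k)%N ==> ~~ hit f j].
have Auniq f (j k : 'I_M) : A j f -> A k f -> j = k.
  move=> /andP[hj /forallP nj] /andP[hk /forallP nk].
  apply: ord_inj; apply/eqP; rewrite eqn_leq; apply/andP; split; rewrite leqNgt; apply/negP => jk.
    by have := nj k; rewrite jk hk.
  by have := nk j; rewrite jk hj.
have Aclip k f : A k [ffun i => clip k (f i)] = A k f.
  rewrite /A /hit below_clip //; congr (_ && _); apply: eq_forallb => j.
  by case: ltnP => //= jk; rewrite below_clip // ltnW.
have AE (k : 'I_M) f : A k f -> E <= \prod_i tilt y k (f i).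
  move=> /andP[/andP[Sk Qk] _]; rewrite (bigID (fun i => (f i < k)%N)) /=.
  rewrite (eq_bigr (fun=> y)); last by move=> i ik; rewrite /tilt ik.
  rewrite [X in _ <= _ * X](eq_bigr
    (fun=> (M%:R - y * k%:R) / (M%:R - k%:R))); last first.
    by move=> i /negbTE ik; rewrite /tilt ik.
  rewrite !prodr_const (_ : #|[pred i | ~~ (f i < k)%N]| = n - below f k)%N.
    exact: SQ (below_le f k) Qk.
  have KC := cardC [pred i | (f i < k)%N]; rewrite card_ord in KC.
  rewrite (eq_card (_ : _ =i predC [pred i | (f i < k)%N])).
    by rewrite -[X in (X - _)%N]KC addKn.
  by move=> i; rewrite !inE.
rewrite mulr_natr -sumr_const.
apply: (@le_trans _ _ (\sum_(f : {ffun 'I_n -> 'I_M}) \sum_(k | A k f) \prod_(i < n) tilt y k (f i))).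
  rewrite [leRHS](bigID (mem [pred f : {ffun 'I_n -> 'I_M} | [exists k : 'I_M, S k && Q k (below f k)]])) /=.
  rewrite -[leLHS]addr0; apply: lerD; last first.
    apply: sumr_ge0 => f _; apply: sumr_ge0 => k /andP[/andP[Sk _] _].
    by apply: prodr_ge0 => i _; exact: tilt0.
  apply: ler_sum => f; rewrite inE => /existsP[k1 hk1].
  have [k Akf] : exists k, A k f.
    case: (@arg_minnP _ k1 (fun k : 'I_M => hit f k) (fun k : 'I_M => k : nat) hk1) => k hk kmin.
    exists k; rewrite /A hk /=; apply/forallP => j; apply/implyP => jk.
    by apply/negP => /kmin; rewrite leqNgt jk.
  rewrite (bigD1 k) //= -[leLHS]addr0 lerD ?AE //.
  apply: sumr_ge0 => j /andP[/andP[/andP[Sj _] _] _].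
  by apply: prodr_ge0 => i _; exact: tilt0.
rewrite (exchange_big_dep xpredT) //=.
(* First crossing at k is decided by the letters below k. *)
rewrite (eq_bigr (fun k => \sum_(f | A k f) \prod_i tilt y K (f i))); last first.
  move=> k _; case Sk : (S k); first by apply: sum_tilt_swap => //; exact: Kmax.
  have none f : A k f = false by rewrite /A /hit Sk.
  by rewrite !big_pred0.
rewrite (exchange_big_dep xpredT) //=.
apply: (@le_trans _ _ (\sum_(f : {ffun 'I_n -> 'I_M}) \prod_(i < n) tilt y K (f i))); last first.
  rewrite -(bigA_distr_bigA (fun=> tilt y K \o val)) /=.
  by rewrite prodr_const card_ord sum_tilt.
apply: ler_sum => f _; rewrite sumr_const -[leLHS]mulr_natr.
have P0 : 0 <= \prod_i tilt y K (f i).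
  by apply: prodr_ge0 => i _; exact: tilt0.
rewrite ler_piMr // -[1]/(1%:R) ler_nat.
rewrite leqNgt; apply/negP => /card_gt1P[j [k [Aj Ak]]].
by rewrite (Auniq f j k) ?eqxx.
Qed.

End FirstCrossing.

Lemma expR_mixed (R : realType) (y r : R) (N n : nat) : 0 < y -> 0 < r ->
  (N <= n)%N -> y ^+ N * r ^+ (n - N) = expR (n%:R * ln r + N%:R * (ln y - ln r)).
Proof.
move=> y0 r0 Nn; rewrite -{1}(lnK (x := y)) ?posrE // -{1}(lnK (x := r)) ?posrE //.
rewrite -!expRM_natl -expRD natrB //; congr expR; ring.
Qed.

Section UpperDeviation.
Variables (R : realType) (n M : nat) (e : R).
Hypotheses (n0 : (0 < n)%N) (M0 : (0 < M)%N) (e0 : 0 < e) (e47 : 7 * e <= 4).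
Implicit Types f : {ffun 'I_n -> 'I_M}.

Lemma card_crossing_above :
  expR (2 * n%:R * e ^+ 2) * #|[pred f : {ffun 'I_n -> 'I_M} | [exists k : 'I_M,
     (2 * k%:R <= (1 - e) * M%:R) &&
     (n%:R * (k%:R / M%:R + e) <= (below f k)%:R)]]|%:R <= M%:R ^+ n.
Proof.
have e0' := e0; have e47' := e47.
have M0' : 0 < M%:R :> R by rewrite ltr0n.
have n0' : 0 < n%:R :> R by rewrite ltr0n.
pose y := (1 + e) / (1 - e).
have y1 : 1 <= y by rewrite /y ler_pdivlMr; lra.
pose S (k : nat) := (k < M)%N && (2 * k%:R <= (1 - e) * M%:R).
pose Q (k N : nat) := n%:R * (k%:R / M%:R + e) <= N%:R.
have yt (t : R) : 2 * t <= 1 - e -> 0 < 1 - y * t.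
  move=> te; have e1 : 0 < 1 - e by lra.
  have : 0 <= (1 + e) * (1 - e - 2 * t) by rewrite mulr_ge0 //; lra.
  have : 0 < (1 - e) * (1 - e) by rewrite mulr_gt0.
  rewrite /y subr_gt0 mulrAC ltr_pdivrMr // mul1r; lra.
have tk k : S k -> 2 * (k%:R / M%:R) <= 1 - e.
  by move=> /andP[_ kM]; rewrite mulrA ler_pdivrMr.
have := @first_crossing_bound R n M S Q y (expR (2 * n%:R * e ^+ 2)).
rewrite (eq_card (_ : _ =i [pred f : {ffun 'I_n -> 'I_M} | [exists k : 'I_M,
     (2 * k%:R <= (1 - e) * M%:R) &&
     (n%:R * (k%:R / M%:R + e) <= (below f k)%:R)]])); last first.
  by move=> f; rewrite !inE; apply: eq_existsb => k; rewrite /S ltn_ord.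
apply; first by lra.
  move=> k Sk; rewrite (andP Sk).1 /=.
  have := yt _ (tk _ Sk); rewrite mulrA subr_gt0 ltr_pdivrMr // mul1r; exact: ltW.
move=> k N Sk Nn QkN; have kM := (andP Sk).1.
set t : R := k%:R / M%:R.
have t0 : 0 <= t by rewrite divr_ge0.
have te : 2 * t <= 1 - e := tk _ Sk.
have -> : (M%:R - y * k%:R) / (M%:R - k%:R) = (1 - y * t) / (1 - t).
  have kM' : k%:R < M%:R :> R by rewrite ltr_nat.
  by rewrite /t; field; apply/andP; split; apply/eqP; lra.
set r := (1 - y * t) / (1 - t).
have r0 : 0 < r by rewrite divr_gt0 ?yt //; lra.
have r1 : r <= 1.
  rewrite ler_pdivrMr; last by lra.
  by rewrite mul1r lerD2l lerN2 ler_peMl.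
rewrite expR_mixed //; last by lra.
rewrite ler_expR.
have ineq : 2 * e ^+ 2 <= (t + e) * ln y + (1 - t - e) * ln r.
  by apply: tilt_up_ineq => //; lra.
have lyr : 0 <= ln y - ln r.
  have := ln_ge0 y1; have := ln_le0 r1; lra.
have := ler_wpM2r lyr QkN; rewrite -/t => h.
have := ler_wpM2l (ltW n0') ineq => h'.
lra.
Qed.

Lemma card_crossing_below :
  expR (2 * n%:R * e ^+ 2) * #|[pred f : {ffun 'I_n -> 'I_M} | [exists k : 'I_M,
     (2 * k%:R <= (1 + e) * M%:R) &&
     ((below f k)%:R <= n%:R * (k%:R / M%:R - e))]]|%:R <= M%:R ^+ n.
Proof.
have e0' := e0; have e47' := e47.
have M0' : 0 < M%:R :> R by rewrite ltr0n.
have n0' : 0 < n%:R :> R by rewrite ltr0n.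
pose h := e * (1 + e / 3).
have h0 : 0 < h by rewrite /h mulr_gt0 //; lra.
have h1 : h < 1 by rewrite /h; nra.
pose v := (1 - h) / (1 + h).
have v0 : 0 < v by rewrite divr_gt0 //; lra.
have v1 : v <= 1 by rewrite ler_pdivrMr; lra.
pose S (k : nat) := (k < M)%N && (2 * k%:R <= (1 + e) * M%:R).
pose Q (k N : nat) := N%:R <= n%:R * (k%:R / M%:R - e).
have tk k : S k -> 2 * (k%:R / M%:R) <= 1 + e.
  by move=> /andP[_ kM]; rewrite mulrA ler_pdivrMr.
have := @first_crossing_bound R n M S Q v (expR (2 * n%:R * e ^+ 2)).
rewrite (eq_card (_ : _ =i [pred f : {ffun 'I_n -> 'I_M} | [exists k : 'I_M,
     (2 * k%:R <= (1 + e) * M%:R) &&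
     ((below f k)%:R <= n%:R * (k%:R / M%:R - e))]])); last first.
  by move=> f; rewrite !inE; apply: eq_existsb => k; rewrite /S ltn_ord.
apply; first exact: ltW.
  move=> k Sk; rewrite (andP Sk).1 /=.
  apply: (@le_trans _ _ k%:R); first by rewrite ler_piMl.
  by rewrite ler_nat ltnW // (andP Sk).1.
move=> k N Sk Nn QkN; have kM := (andP Sk).1.
set s : R := k%:R / M%:R.
have s1 : s < 1 by rewrite /s ltr_pdivrMr // mul1r ltr_nat.
have se : 2 * s <= 1 + e := tk _ Sk.
have es : e <= s.
  rewrite -subr_ge0 -(pmulr_rge0 _ n0'); exact: le_trans QkN.
have -> : (M%:R - v * k%:R) / (M%:R - k%:R) = (1 - v * s) / (1 - s).
  have kM' : k%:R < M%:R :> R by rewrite ltr_nat.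
  by rewrite /s; field; apply/andP; split; apply/eqP; lra.
set r := (1 - v * s) / (1 - s).
have r1 : 1 <= r.
  rewrite ler_pdivlMr; last by lra.
  by rewrite mul1r lerD2l lerN2 ler_piMl //; lra.
rewrite expR_mixed //; last by lra.
rewrite ler_expR.
have ineq : 2 * e ^+ 2 <= (s - e) * ln v + (1 - s + e) * ln r.
  exact: (@tilt_down_ineq R e s h v).
have lvr : ln v - ln r <= 0.
  have := ln_ge0 r1; have := ln_le0 v1; lra.
have := ler_wnM2r lvr QkN; rewrite -/s => hh.
have := ler_wpM2l (ltW n0') ineq => h'.
lra.
Qed.

(** Exchanges the two halves of the alphabet, and excesses with deficits. *)
Definition mirror f : {ffun 'I_n -> 'I_M} := [ffun i => rev_ord (f i)].

Lemma mirrorK : involutive mirror.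
Proof. by move=> f; apply/ffunP => i; rewrite !ffunE rev_ordK. Qed.

Lemma below_mirror f k : (k <= M)%N -> (below (mirror f) (M - k) = n - below f k)%N.
Proof.
move=> kM; have KC := cardC [pred i | (f i < k)%N]; rewrite card_ord in KC.
rewrite /below (eq_card (_ : _ =i predC [pred i | (f i < k)%N])).
  by rewrite -[X in (X - _)%N]KC addKn.
by move=> i; rewrite !inE ffunE /=; have := ltn_ord (f i); lia.
Qed.

Lemma card_mirror (A B : pred {ffun 'I_n -> 'I_M}) :
  (forall f, A f -> B (mirror f)) -> (#|[pred f : {ffun 'I_n -> 'I_M} | A f]| <= #|[pred f : {ffun 'I_n -> 'I_M} | B f]|)%N.
Proof.
move=> AB; rewrite -(card_imset _ (can_inj mirrorK)).
by apply: subset_leq_card; apply/fintype.subsetP => _ /imsetP[f Af ->]; exact: AB.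
Qed.

Definition deviates_up f : bool := [exists k : 'I_M.+1,
  n%:R * (k%:R / M%:R + e) <= (below f k)%:R].

(** Crossings in the left half are counted by [card_crossing_above]; an excess at a level
    of the right half is a deficit of the mirrored word at a level of the left half. *)
Lemma card_deviates_up :
  expR (2 * n%:R * e ^+ 2) * #|[pred f : {ffun 'I_n -> 'I_M} | deviates_up f]|%:R <= 2 * M%:R ^+ n.
Proof.
have e0' := e0; have e47' := e47.
have M0' : 0 < M%:R :> R by rewrite ltr0n.
have n0' : 0 < n%:R :> R by rewrite ltr0n.
pose L f := [exists k : 'I_M, (2 * k%:R <= (1 - e) * M%:R) &&
     (n%:R * (k%:R / M%:R + e) <= (below f k)%:R)].
pose D f := [exists k : 'I_M, (2 * k%:R <= (1 + e) * M%:R) &&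
     ((below f k)%:R <= n%:R * (k%:R / M%:R - e))].
have sub : (#|[pred f : {ffun 'I_n -> 'I_M} | deviates_up f]| <= #|[pred f : {ffun 'I_n -> 'I_M} | L f]| + #|[pred f : {ffun 'I_n -> 'I_M} | D f]|)%N.
  have mD : (#|[pred f : {ffun 'I_n -> 'I_M} | D (mirror f)]| <= #|[pred f : {ffun 'I_n -> 'I_M} | D f]|)%N.
    exact: (@card_mirror (fun f => D (mirror f)) D).
  apply: leq_trans (leq_add (leqnn _) mD).
  rewrite -cardUI; apply: leq_trans (leq_addr _ _).
  apply: subset_leq_card; apply/fintype.subsetP => f; rewrite !inE => /existsP[k hk].
  have kM : (k < M)%N.
    rewrite ltn_neqAle -ltnS ltn_ord andbT; apply/eqP => kM; move: hk.
    rewrite kM divff ?gt_eqF // leNgt => /negP; apply.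
    apply: (@le_lt_trans _ _ n%:R); first by rewrite ler_nat below_le.
    by rewrite ltr_pMr //; lra.
  have [kl|kl] := leP (2 * k%:R) ((1 - e) * M%:R).
    by apply/orP; left; apply/existsP; exists (Ordinal kM); rewrite /= kl hk.
  apply/orP; right; have k0 : (0 < k)%N.
    rewrite lt0n; apply/eqP => k0; move: kl; rewrite k0 mulr0.
    by rewrite ltNge mulr_ge0 //; lra.
  have kM' : (M - k < M)%N by lia.
  apply/existsP; exists (Ordinal kM') => /=.
  rewrite below_mirror ?(ltnW kM) // !natrB ?(ltnW kM) ?below_le //.
  rewrite mulrBl divff ?gt_eqF //; apply/andP; split; lra.
apply: (@le_trans _ _ (expR (2 * n%:R * e ^+ 2) * (#|[pred f : {ffun 'I_n -> 'I_M} | L f]|%:R + #|[pred f : {ffun 'I_n -> 'I_M} | D f]|%:R))).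
  by rewrite ler_wpM2l ?expR_ge0 // -natrD ler_nat.
rewrite mulrDr.
have h1 : expR (2 * n%:R * e ^+ 2) * #|[pred f : {ffun 'I_n -> 'I_M} | L f]|%:R <= M%:R ^+ n.
  exact: card_crossing_above.
have h2 : expR (2 * n%:R * e ^+ 2) * #|[pred f : {ffun 'I_n -> 'I_M} | D f]|%:R <= M%:R ^+ n.
  exact: card_crossing_below.
lra.
Qed.

Definition deviates f : bool := [exists k : 'I_M.+1,
  n%:R * e <= `|(below f k)%:R - n%:R * (k%:R / M%:R)|].

Lemma card_deviates :
  expR (2 * n%:R * e ^+ 2) * #|[pred f : {ffun 'I_n -> 'I_M} | deviates f]|%:R <= 4 * M%:R ^+ n.
Proof.
have e0' := e0; have e47' := e47.
have M0' : 0 < M%:R :> R by rewrite ltr0n.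
have sub : (#|[pred f : {ffun 'I_n -> 'I_M} | deviates f]| <= #|[pred f : {ffun 'I_n -> 'I_M} | deviates_up f]| + #|[pred f : {ffun 'I_n -> 'I_M} | deviates_up f]|)%N.
  have mD : (#|[pred f : {ffun 'I_n -> 'I_M} | deviates_up (mirror f)]| <= #|[pred f : {ffun 'I_n -> 'I_M} | deviates_up f]|)%N.
    exact: (@card_mirror (fun f => deviates_up (mirror f)) deviates_up).
  apply: leq_trans (leq_add (leqnn _) mD).
  rewrite -cardUI; apply: leq_trans (leq_addr _ _).
  apply: subset_leq_card; apply/fintype.subsetP => f; rewrite !inE => /existsP[k].
  rewrite ler_normr => /orP[] hk.
    by apply/orP; left; apply/existsP; exists k; lra.
  apply/orP; right; have kM : (k <= M)%N by rewrite -ltnS.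
  apply/existsP; exists (rev_ord k) => /=.
  rewrite subSS below_mirror // !natrB ?below_le //.
  rewrite mulrBl divff ?gt_eqF //; lra.
have := card_deviates_up => h.
apply: (@le_trans _ _ (expR (2 * n%:R * e ^+ 2) * (#|[pred f : {ffun 'I_n -> 'I_M} | deviates_up f]|%:R + #|[pred f : {ffun 'I_n -> 'I_M} | deviates_up f]|%:R))).
  by rewrite ler_wpM2l ?expR_ge0 // -natrD ler_nat.
lra.
Qed.

End UpperDeviation.

(** * Inner products, halfspaces and exceptional events *)

Section Geometry.
Variables (R : realType) (d : nat).
Implicit Types (x y u q : 'rV[R]_d).

Lemma dotprodC x y : dotprod x y = dotprod y x.
Proof. by apply: eq_bigr => i _; rewrite mulrC. Qed.

Lemma dotprodDl x y u : dotprod (x + y) u = dotprod x u + dotprod y u.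
Proof. by rewrite -big_split; apply: eq_bigr => i _; rewrite mxE mulrDl. Qed.

Lemma dotprodZl a x u : dotprod (a *: x) u = a * dotprod x u.
Proof. by rewrite /dotprod mulr_sumr; apply: eq_bigr => i _; rewrite mxE mulrA. Qed.

Lemma dotprodDr x y u : dotprod u (x + y) = dotprod u x + dotprod u y.
Proof. by rewrite dotprodC dotprodDl !(dotprodC u). Qed.

Lemma dotprodZr a x u : dotprod u (a *: x) = a * dotprod u x.
Proof. by rewrite dotprodC dotprodZl dotprodC. Qed.

Lemma dotprodNl x u : dotprod (- x) u = - dotprod x u.
Proof. by rewrite -scaleN1r dotprodZl mulN1r. Qed.

Lemma dotprodNr x u : dotprod u (- x) = - dotprod u x.
Proof. by rewrite dotprodC dotprodNl dotprodC. Qed.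

Lemma dotprod_ge0 x : 0 <= dotprod x x.
Proof. by apply: sumr_ge0 => i _; rewrite -expr2 sqr_ge0. Qed.

Lemma dotprod_gt0 x : x != 0 -> 0 < dotprod x x.
Proof.
move=> x0; rewrite lt_neqAle dotprod_ge0 andbT eq_sym; apply: contraNneq x0.
move=> /eqP; rewrite psumr_eq0 => [/allP x0|i _]; last by rewrite -expr2 sqr_ge0.
apply/eqP/rowP => i; rewrite mxE; apply/eqP.
by have := x0 i (mem_index_enum i); rewrite /= mulf_eq0 orbb.
Qed.

Lemma enorm_ge0 x : 0 <= enorm x. Proof. exact: sqrtr_ge0. Qed.

Lemma enorm_sqr x : enorm x ^+ 2 = dotprod x x.
Proof. by rewrite sqr_sqrtr // dotprod_ge0. Qed.

Lemma enorm_gt0 x : x != 0 -> 0 < enorm x.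
Proof. by move=> /dotprod_gt0; rewrite sqrtr_gt0. Qed.

Lemma cauchy_schwarz x y : `|dotprod x y| <= enorm x * enorm y.
Proof.
rewrite -ler_sqr ?nnegrE ?mulr_ge0 ?enorm_ge0 //.
rewrite exprMn !enorm_sqr real_normK ?num_real //.
have [->|y0] := eqVneq y 0.
  have -> (z : 'rV[R]_d) : dotprod z 0 = 0 by rewrite -(scale0r z) dotprodZr mul0r.
  by rewrite expr0n mulr_ge0 ?dotprod_ge0.
have yy := dotprod_gt0 y0.
have := dotprod_ge0 (dotprod y y *: x + - dotprod x y *: y).
rewrite !(dotprodDl, dotprodDr, dotprodZl, dotprodZr) (dotprodC y x).
move=> h; rewrite -subr_ge0 -(pmulr_rge0 _ yy); apply: le_trans h _.
by rewrite le_eqVlt; apply/orP; left; apply/eqP; ring.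
Qed.

Lemma sphere_dot u : sphere u -> dotprod u u = 1.
Proof. by move=> su; rewrite -enorm_sqr su expr1n. Qed.

Lemma sphere_normalize u : u != 0 -> sphere ((enorm u)^-1 *: u).
Proof.
move=> u0; have a0 := gt_eqF (enorm_gt0 u0).
have e1 : dotprod ((enorm u)^-1 *: u) ((enorm u)^-1 *: u) = 1.
  by rewrite dotprodZl dotprodZr -enorm_sqr; field; rewrite a0.
by rewrite /sphere /= {1}/enorm e1 sqrtr1.
Qed.

Lemma dotprod_continuous u : continuous (fun x => dotprod x u).
Proof.
rewrite /dotprod; apply: continuous_big => [|i _ x]; first exact: add_continuous.
apply: (@continuousM R _ (fun x => x ord0 i) (fun=> u ord0 i) x).
  exact: coord_continuous.
exact: cst_continuous.
Qed.

Lemma dotprod_self_continuous : continuous (fun x => dotprod x x).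
Proof.
rewrite /dotprod; apply: continuous_big => [|i _ x]; first exact: add_continuous.
by apply: (@continuousM R _ (fun x => x ord0 i) (fun x => x ord0 i) x);
  exact: coord_continuous.
Qed.

Lemma open_borelRd (A : set 'rV[R]_d) : open A -> measurable (A : set (borelRd R d)).
Proof. exact: sub_sigma_algebra. Qed.

Lemma measurable_dotprod_lt u c :
  measurable ([set x | dotprod x u < c] : set (borelRd R d)).
Proof.
apply: open_borelRd; rewrite (_ : [set x | _] = (fun x => dotprod x u) @^-1` [set y | y < c]) //.
by apply: open_comp; [move=> x _; exact: dotprod_continuous|exact: open_lt].
Qed.

Lemma measurable_dotprod_ge u c :
  measurable ([set x | c <= dotprod x u] : set (borelRd R d)).
Proof.
rewrite (_ : [set x | _] = ~` [set x | dotprod x u < c]).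
  by apply: measurableC; exact: measurable_dotprod_lt.
by apply/seteqP; split => x /=; rewrite leNgt => /negP.
Qed.

Lemma measurable_dotprod_le u c :
  measurable ([set x | dotprod x u <= c] : set (borelRd R d)).
Proof.
rewrite (_ : [set x | _] = [set x | - c <= dotprod x (- u)]).
  exact: measurable_dotprod_ge.
by apply/seteqP; split => x /=; rewrite dotprodNr lerN2.
Qed.

Lemma measurable_enorm_gt c : 0 <= c ->
  measurable ([set x | c < enorm x] : set (borelRd R d)).
Proof.
move=> c0; apply: open_borelRd.
rewrite (_ : [set x | _] = (fun x => dotprod x x) @^-1` [set y | c ^+ 2 < y]).
  by apply: open_comp; [move=> x _; exact: dotprod_self_continuous|exact: open_gt].
by apply/seteqP; split => x /=; rewrite -enorm_sqr ltr_sqr ?nnegrE ?enorm_ge0.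
Qed.

Definition empirical_cdf n (x : 'I_n -> 'rV[R]_d) u (t : R) : R :=
  #|[pred i : 'I_n | dotprod (x i) u <= t]|%:R / n%:R.

End Geometry.

Section OffSmall.
Context (R : realType) (dT : measure_display) (T : measurableType dT)
  (P : probability T R).

(** Holding outside an event of probability at most [c].  The exceptional event is part
    of the data, so that statements about all thresholds or all directions can be
    handled without knowing that they define measurable sets. *)
Definition off_small (c : R) (G : T -> Prop) : Prop :=
  exists B : set T, [/\ measurable B, (P B <= c%:E)%E & forall w, ~ B w -> G w].

Lemma off_small_sub (c c' : R) (G G' : T -> Prop) : c <= c' ->
  (forall w, G w -> G' w) -> off_small c G -> off_small c' G'.
Proof.
move=> cc GG' [B [mB PB BG]]; exists B; split => //; last by move=> w /BG /GG'.
by apply: le_trans PB _; rewrite lee_fin.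
Qed.

Lemma off_small_and (c c' : R) (G G' : T -> Prop) :
  off_small c G -> off_small c' G' ->
  off_small (c + c') (fun w => G w /\ G' w).
Proof.
move=> [B [mB PB BG]] [B' [mB' PB' BG']]; exists (B `|` B'); split.
- exact: measurableU.
- by apply: le_trans (measureU2 P mB mB') _; rewrite EFinD leeD.
- by move=> w nB; split; [apply: BG|apply: BG'] => h; apply: nB; [left|right].
Qed.

Lemma off_small_all (I : eqType) (s : seq I) (c : R) (G : I -> T -> Prop) :
  (forall i, i \in s -> off_small c (G i)) ->
  off_small ((size s)%:R * c) (fun w => forall i, i \in s -> G i w).
Proof.
elim: s => [_|a s IH h].
  by exists set0; split => //; rewrite measure0 mul0r.
have ha : off_small c (G a) by apply: h; rewrite mem_head.
have hs := IH (fun i si => h i (mem_behead (si : i \in behead (a :: s)))).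
apply: off_small_sub (off_small_and ha hs); first by rewrite /= -natr1; lra.
by move=> w [Ga Gs] i; rewrite inE => /predU1P[->//|]; exact: Gs.
Qed.

Lemma off_small_prob (c : R) (E : set T) : measurable E -> off_small c E ->
  ((1 - c)%:E <= P E)%E.
Proof.
move=> mE [B [mB PB BE]].
apply: (@le_trans _ _ (P (~` B))); last first.
  by apply: le_measure; rewrite ?inE //; exact: measurableC.
by rewrite probability_setC // EFinB leeB.
Qed.

End OffSmall.

(** * From words to independent samples *)

Section Sampling.
Context (R : realType) (d : nat) (dT : measure_display)
  (T : measurableType dT) (P : probability T R).
Variables (X : {RV P >-> borelRd R d}) (Xs : nat -> {RV P >-> borelRd R d}).
Hypothesis hindep : independent_seq Xs.
Hypothesis hid : forall i, same_distribution (Xs i) X.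

Lemma measurable_RV (Y : {RV P >-> borelRd R d}) (A : set (borelRd R d)) :
  measurable A -> measurable (Y @^-1` A).
Proof. by move=> mA; rewrite -[X in measurable X]setTI; exact: measurable_funPT. Qed.

Lemma same_prob (i : nat) (A : set (borelRd R d)) : measurable A ->
  P (Xs i @^-1` A) = P (X @^-1` A).
Proof. by move=> mA; exact: hid. Qed.

(** Joint independence used on the first [n] indices, in the form of a product over
    ['I_n] with all marginals those of [X]. *)
Lemma prob_sample_box n (C : 'I_n -> set (borelRd R d)) : (forall i, measurable (C i)) ->
  measurable [set w | forall i : 'I_n, C i (Xs i w)] /\
  P [set w | forall i : 'I_n, C i (Xs i w)] = (\prod_(i < n) P (X @^-1` C i))%E.
Proof.
move=> mC; pose B (j : nat) : set (borelRd R d) :=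
  if insub j is Some i then C i else setT.
have mB j : measurable (B j) by rewrite /B; case: insub.
have BC (i : 'I_n) : B i = C i by rewrite /B valK.
have -> : [set w | forall i : 'I_n, C i (Xs i w)] =
    \bigcap_(j in [set` iota 0 n]) (Xs j @^-1` B j).
  apply/seteqP; split => w /=.
    move=> h j /=; rewrite mem_iota add0n /= => jn.
    by rewrite -[j]/(val (Ordinal jn)) BC; exact: h.
  move=> h i; have := h i; rewrite /= mem_iota /= add0n ltn_ord BC; exact.
split.
  apply: fin_bigcap_measurable => [|j _]; first exact: finite_seq.
  exact: measurable_RV.
have io : iota 0 n = index_iota 0 n by rewrite /index_iota subn0.
rewrite (hindep (iota_uniq 0 n) mB) io big_mkord; apply: eq_bigr => i _.
by rewrite same_prob // BC.
Qed.

Section Grid.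
Variables (D : nat -> set (borelRd R d)) (M : nat).
Hypothesis M0 : (0 < M)%N.
Hypothesis mD : forall k, measurable (D k).
Hypothesis D0 : D 0 = set0.
Hypothesis DM : D M = setT.
Hypothesis Dmono : forall j k, (j <= k)%N -> D j `<=` D k.
Hypothesis PD : forall k, (k <= M)%N -> P (X @^-1` D k) = (k%:R / M%:R)%:E.

(** Cells of an increasing chain of sets; they have probability [1 / M] each. *)
Definition cell (j : nat) : set (borelRd R d) := D j.+1 `\` D j.

Lemma measurable_cell j : measurable (cell j).
Proof. exact: measurableD. Qed.

Lemma exists_cell x : exists j : 'I_M, cell j x.
Proof.
have exk : exists k, `[< D k x >] by exists M; apply/asboolP; rewrite DM.
case: (ex_minnP exk) => k /asboolP Dk kmin.
have k0 : (0 < k)%N by rewrite lt0n; apply/eqP => k0; move: Dk; rewrite k0 D0.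
have kM : (k <= M)%N by apply: kmin; apply/asboolP; rewrite DM.
have jM : (k.-1 < M)%N by rewrite prednK.
exists (Ordinal jM); split; rewrite /= ?prednK //.
by move=> /asboolP /kmin; rewrite leqNgt prednK // leqnn.
Qed.

Lemma cellE j k x : cell j x -> D k x <-> (j < k)%N.
Proof.
move=> [Dj nDj]; split => [Dk|jk]; last exact: (Dmono jk).
by rewrite ltnNge; apply/negP => kj; apply/nDj/(Dmono kj).
Qed.

Lemma prob_cell (j : 'I_M) : P (X @^-1` cell j) = (M%:R^-1)%:E.
Proof.
have -> : P (X @^-1` cell j) = (P (X @^-1` D j.+1) - P (X @^-1` D j))%E.
  rewrite -[X @^-1` cell j]/((X @^-1` D j.+1) `\` (X @^-1` D j)) measureD; first last.
  - by rewrite ltey_eq fin_num_measure //; exact: measurable_RV.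
  - exact: measurable_RV.
  - exact: measurable_RV.
  rewrite (_ : _ `&` _ = X @^-1` D j) //.
  apply/seteqP; split => w /=; first by case.
  by move=> Dj; split => //; apply: (Dmono (leqnSn j)).
rewrite !PD ?(ltnW (ltn_ord j)) // -EFinB; congr EFin.
by rewrite -mulrBl -natr1 addrAC subrr add0r mul1r.
Qed.

(** The cells of the sample points form a word, and each word has probability at most
    [M ^- n]: the count of deviating words is a bound on the probability. *)
Lemma grid_deviation (n : nat) (e : R) : (0 < n)%N -> 0 < e -> 7 * e <= 4 ->
  off_small P (4 * expR (- (2 * n%:R * e ^+ 2)))
   (fun w => forall k, (k <= M)%N ->
      `|#|[pred i : 'I_n | `[< D k (Xs i w) >]]|%:R - n%:R * (k%:R / M%:R)| < n%:R * e).
Proof.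
move=> n0 e0 e47.
pose s := enum [pred f : {ffun 'I_n -> 'I_M} | deviates e f].
pose G (f : {ffun 'I_n -> 'I_M}) (w : T) := ~ (forall i, cell (f i) (Xs i w)).
have := @off_small_all R dT T P _ s ((M%:R^-1) ^+ n) G.
have hG f : f \in s -> off_small P ((M%:R^-1) ^+ n) (G f).
  move=> _; exists [set w | forall i : 'I_n, cell (f i) (Xs i w)].
  have [mC ->] := @prob_sample_box n (fun i => cell (f i)) (fun i => measurable_cell _).
  split => //; under eq_bigr do rewrite prob_cell.
  by rewrite prodEFin prodr_const card_ord.
move=> /(_ hG); apply: off_small_sub.
  have := card_deviates n0 M0 e0 e47; rewrite /s -cardE.
  have M0' : 0 < M%:R ^+ n :> R by rewrite exprn_gt0 // ltr0n.
  move=> h; rewrite exprVn ler_pdivrMr // expRN mulrAC ler_pdivlMr ?expR_gt0 //.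
  by rewrite mulrC.
move=> w hw k kM; have [f hf] := choice (fun i : 'I_n => exists_cell (Xs i w)).
pose F := [ffun i => f i].
have Fs : F \notin s by apply/negP => /hw; apply => i; rewrite ffunE.
have -> : #|[pred i : 'I_n | `[< D k (Xs i w) >]]| = below F k.
  apply: eq_card => i; rewrite !inE ffunE.
  by apply/asboolP/idP => /(cellE k (hf i)).
rewrite ltNge; apply: contraNN Fs => h.
rewrite mem_enum inE; apply/existsP.
have k1 : (k < M.+1)%N by [].
by exists (Ordinal k1).
Qed.

(** A given pair of sample points shares a given cell with probability [M ^- 2], and there
    are [M] cells and fewer than [n * n] pairs. *)
Lemma grid_collision (n : nat) :
  off_small P ((n * n)%:R / M%:R) (fun w => forall i j : 'I_n, i != j ->
    forall k : nat, ~ (cell k (Xs i w) /\ cell k (Xs j w))).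
Proof.
pose s := enum [pred p : 'I_n * 'I_n | p.1 != p.2].
pose G (p : 'I_n * 'I_n) (w : T) := forall k : 'I_M,
  ~ (cell k (Xs p.1 w) /\ cell k (Xs p.2 w)).
have := @off_small_all R dT T P _ s (M%:R^-1) G.
have hG p : p \in s -> off_small P (M%:R^-1) (G p).
  rewrite mem_enum inE => pne.
  have := @off_small_all R dT T P _ (enum 'I_M) (M%:R^-1 * M%:R^-1)
    (fun k w => ~ (cell k (Xs p.1 w) /\ cell k (Xs p.2 w))).
  have hk (k : 'I_M) : k \in enum 'I_M -> off_small P (M%:R^-1 * M%:R^-1)
     (fun w => ~ (cell k (Xs p.1 w) /\ cell k (Xs p.2 w))).
    move=> _; exists ((Xs p.1 @^-1` cell k) `&` (Xs p.2 @^-1` cell k)); split => //.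
      by apply: measurableI; apply: measurable_RV; exact: measurable_cell.
    have un : uniq [:: p.1 : nat; p.2 : nat] by rewrite /= inE pne.
    have := hindep un (fun=> measurable_cell k).
    have pc i : P (Xs i @^-1` cell k) = (M%:R^-1)%:E.
      by rewrite same_prob ?prob_cell //; exact: measurable_cell.
    rewrite !big_cons big_nil mule1 !pc.
    rewrite -EFinM => <-; rewrite le_eqVlt; apply/orP; left; apply/eqP; congr (P _).
    apply/seteqP; split => w /=.
      by move=> [h1 h2] j /=; rewrite !inE => /orP[] /eqP ->.
    by move=> h; split; apply: h; rewrite /= !inE eqxx ?orbT.
  move=> /(_ hk); apply: off_small_sub.
    by rewrite size_enum_ord mulrA divff ?mul1r // pnatr_eq0 -lt0n.
  by move=> w hw k; apply: hw; rewrite mem_enum.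
move=> /(_ hG); apply: off_small_sub.
  rewrite ler_wpM2r ?invr_ge0 // ler_nat -cardE.
  by apply: leq_trans (max_card _) _; rewrite card_prod card_ord.
move=> w hw i j ij k [ci cj].
have kM : (k < M)%N.
  by rewrite -(cellE M ci) DM.
by apply: (hw (i, j) _ (Ordinal kM)); rewrite ?mem_enum ?inE.
Qed.

End Grid.
End Sampling.

(** * Uniform deviation of one projection *)

Section Projection.
Context (R : realType) (d : nat) (dT : measure_display)
  (T : measurableType dT) (P : probability T R).
Variables (X : {RV P >-> borelRd R d}) (Xs : nat -> {RV P >-> borelRd R d}).
Hypothesis hindep : independent_seq Xs.
Hypothesis hid : forall i, same_distribution (Xs i) X.
Variables (L : R) (theta : 'rV[R]_d).
Hypothesis hproj : projection_lipschitz P X L.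
Hypothesis htheta : sphere theta.

Local Notation F := (projection_cdf P X theta).

Lemma measurable_proj_le (Y : {RV P >-> borelRd R d}) (u : 'rV[R]_d) (t : R) :
  measurable [set w | dotprod (Y w) u <= t].
Proof. exact: (measurable_RV Y (measurable_dotprod_le u t)). Qed.

Lemma measurable_proj_ge (Y : {RV P >-> borelRd R d}) (u : 'rV[R]_d) (t : R) :
  measurable [set w | t <= dotprod (Y w) u].
Proof. exact: (measurable_RV Y (measurable_dotprod_ge u t)). Qed.

Lemma prob_fineK (A : set T) : measurable A -> (fine (P A))%:E = P A.
Proof. by move=> mA; rewrite fineK // fin_num_measure. Qed.

Lemma fine_prob_ge0 (A : set T) : 0 <= fine (P A).
Proof. exact: fine_ge0. Qed.

Lemma fine_prob_mono (A B : set T) : measurable A -> measurable B -> A `<=` B ->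
  fine (P A) <= fine (P B).
Proof.
by move=> mA mB AB; rewrite -lee_fin !prob_fineK //; apply: le_measure; rewrite ?inE.
Qed.

(** Continuity of a probability along increasing events. *)
Lemma prob_exhaust (A : nat -> set T) (a : R) : (forall n, measurable (A n)) ->
  (forall m n, (m <= n)%N -> A m `<=` A n) -> \bigcup_n A n = setT ->
  a < 1 -> exists n, a < fine (P (A n)).
Proof.
move=> mA Amono AT a1; apply/not_existsP => h.
have cv : (P \o A) n @[n --> \oo] --> P (\bigcup_n A n).
  apply: nondecreasing_cvg_mu => //; first exact: bigcup_measurable.
  by move=> m n mn; apply/subsetPset; exact: Amono.
have : (P setT <= a%:E)%E.
  rewrite -AT -(cvg_lim _ cv) //; apply: lime_le.
    by apply/cvg_ex; eexists; exact: cv.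
  apply: nearW => n /=; rewrite -prob_fineK // lee_fin leNgt.
  by apply/negP; exact: h.
by rewrite probability_setT lee_fin leNgt a1.
Qed.

Lemma proj_cdf_mono s t : s <= t -> F s <= F t.
Proof.
move=> st; apply: fine_prob_mono; try exact: measurable_proj_le.
by move=> w /= h; exact: le_trans st.
Qed.

Lemma proj_cdf_large a : a < 1 -> exists t, a < F t.
Proof.
move=> a1; have := @prob_exhaust (fun n => [set w | dotprod (X w) theta <= n%:R]) a.
case=> //.
- by move=> n; exact: measurable_proj_le.
- by move=> m n mn w /= h; apply: le_trans h _; rewrite ler_nat.
- apply/seteqP; split => // w _; exists (Num.trunc (dotprod (X w) theta)).+1 => //=.
  exact/ltW/truncnS_gt.
- by move=> n h; exists n%:R.
Qed.

Lemma proj_cdf_small a : 0 < a -> exists t, F t < a.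
Proof.
move=> a0; have := @prob_exhaust (fun n => ~` [set w | dotprod (X w) theta <= - n%:R]) (1 - a).
case=> //.
- by move=> n; apply: measurableC; exact: measurable_proj_le.
- move=> m n mn w /= h h'; apply: h; apply: le_trans h' _.
  by rewrite lerN2 ler_nat.
- apply/seteqP; split => // w _; exists (Num.trunc (- dotprod (X w) theta)).+1 => //=.
  by apply/negP; rewrite -ltNge ltrNl truncnS_gt.
- by lra.
move=> n h; exists (- n%:R); move: h.
rewrite -lte_fin prob_fineK; last by apply: measurableC; exact: measurable_proj_le.
rewrite probability_setC; last exact: measurable_proj_le.
rewrite -prob_fineK; last exact: measurable_proj_le.
by rewrite -EFinB lte_fin /projection_cdf; lra.
Qed.

Lemma proj_cdf_continuous : continuous F.
Proof.
case: hproj => L0 hL x; apply/cvgrPdist_le => /= e e0.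
near=> y.
apply: le_trans (hL theta htheta x y) _.
rewrite -ler_pdivlMl //.
near: y; apply: cvgr_dist_le => //.
by rewrite mulr_gt0 // invr_gt0.
Unshelve. all: by end_near. Qed.

Lemma proj_quantile a : 0 < a < 1 -> exists t, F t = a.
Proof.
move=> /andP[a0 a1].
have [t0 h0] := proj_cdf_small a0; have [t1 h1] := proj_cdf_large a1.
have t01 : t0 <= t1.
  by rewrite leNgt; apply/negP => /ltW /proj_cdf_mono; lra.
have [||c _ <-] := @IVT R F t0 t1 a t01; last by exists c.
  by apply: continuous_subspaceT; exact: proj_cdf_continuous.
rewrite ge_min le_max; apply/andP; split; apply/orP; [left|right]; exact: ltW.
Qed.

(** Sublevel sets of the projection at its quantiles of order [k / M], which exist because
    the distribution function is continuous. *)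
Lemma proj_grid (M : nat) : (0 < M)%N -> exists D : nat -> set (borelRd R d),
  [/\ (forall k, measurable (D k)), D 0%N = set0 /\ D M = setT,
      (forall j k, (j <= k)%N -> D j `<=` D k),
      (forall k, (k <= M)%N -> P (X @^-1` D k) = (k%:R / M%:R)%:E) &
      (forall k x y, dotprod x theta <= dotprod y theta -> D k y -> D k x)].
Proof.
move=> M0; have M0' : 0 < M%:R :> R by rewrite ltr0n.
have ex k : exists t, (0 < k < M)%N -> F t = k%:R / M%:R.
  case: (boolP (0 < k < M)%N) => [/andP[k0 kM]|_]; last by exists 0.
  have [|t tE] := @proj_quantile (k%:R / M%:R); last by exists t.
  by rewrite divr_gt0 ?ltr0n //= ltr_pdivrMr // mul1r ltr_nat.
have [s hs] := choice ex.
(* The extreme sets are imposed: the distribution function need not attain 0 or 1. *)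
exists (fun k => if k == 0%N then set0 else if (M <= k)%N then setT
  else [set x | dotprod x theta <= s k]); split.
- move=> k; case: eqP => // _; case: leqP => // _; exact: measurable_dotprod_le.
- by rewrite eqxx leqnn; case: eqP M0 => // ->.
- move=> j k jk; case: (eqVneq j 0%N) => [_|j0]; first by [].
  have k0 : k == 0%N = false by apply/negbTE; lia.
  rewrite k0; case: (leqP M k) => [//|kM]; case: (leqP M j) => [Mj|jM].
    by move: kM; rewrite ltnNge (leq_trans Mj jk).
  move=> x /= h; apply: le_trans h _; move: jk; rewrite leq_eqVlt => /predU1P[->//|jk].
  rewrite leNgt; apply/negP => /ltW /proj_cdf_mono.
  rewrite !hs ?kM ?jM ?andbT; try lia.
  by rewrite ler_pM2r ?invr_gt0 // ler_nat leqNgt jk.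
- move=> k kM; case: eqP => [->|/eqP k0].
    by rewrite preimage_set0 measure0 mul0r.
  case: leqP => [Mk|kM'].
    have -> : k = M by apply/eqP; rewrite eqn_leq kM.
    by rewrite preimage_setT probability_setT divff ?gt_eqF.
  rewrite -hs ?kM' ?lt0n ?k0 // prob_fineK //; exact: measurable_proj_le.
- move=> k x y xy; case: ifP => // _; case: ifP => // _ /=; exact: le_trans.
Qed.

(** Between two consecutive grid points both distribution functions are monotone and the
    true one grows by [1 / M], so the grid controls all thresholds up to [1 / M]. *)
Lemma dkw_projection (n M : nat) (e : R) : (0 < n)%N -> (0 < M)%N -> 0 < e ->
  7 * e <= 4 ->
  off_small P (4 * expR (- (2 * n%:R * e ^+ 2)))
    (fun w => forall t, `|empirical_cdf (fun i : 'I_n => Xs i w) theta t - F t| <= e + M%:R^-1).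
Proof.
move=> n0 M0 e0 e47; have [D [mD [D0 DM] Dmono PD Ddown]] := proj_grid M0.
have n0' : 0 < n%:R :> R by rewrite ltr0n.
have M0' : 0 < M%:R :> R by rewrite ltr0n.
apply: off_small_sub (@grid_deviation _ _ _ _ _ _ _ hindep hid D M M0 mD D0 DM Dmono PD n e n0 e0 e47) => //.
move=> w hw t.
pose H : set 'rV[R]_d := [set x | dotprod x theta <= t].
have exk : exists k, `[< H `<=` D k >] by exists M; apply/asboolP; rewrite DM.
case: (ex_minnP exk) => k /asboolP HDk kmin.
have kM : (k <= M)%N by apply: kmin; apply/asboolP; rewrite DM.
have k0 : (0 < k)%N.
  rewrite lt0n; apply/eqP => k0; move: HDk; rewrite k0 D0 => /(_ (t *: theta)).
  by apply; rewrite /H /= dotprodZl sphere_dot // mulr1.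
(* D k is the first grid set containing the half-line H; sublevel sets of a linear form are nested. *)
have DkH : D k.-1 `<=` H.
  move=> x Dx; apply: contrapT => nHx.
  have : H `<=` D k.-1.
    move=> y Hy; apply: Ddown Dx; apply: le_trans Hy _.
    by move: nHx => /negP; rewrite -ltNge; exact: ltW.
  by move=> /asboolP /kmin; rewrite leqNgt prednK // leqnn.
have card_sub (A B : set 'rV[R]_d) : A `<=` B ->
    (#|[pred i : 'I_n | `[< A (Xs i w) >]]| <= #|[pred i : 'I_n | `[< B (Xs i w) >]]|)%N.
  move=> AB; apply: subset_leq_card; apply/fintype.subsetP => i; rewrite !inE.
  exact: AB.
have cH : #|[pred i : 'I_n | dotprod (Xs i w) theta <= t]| =
          #|[pred i : 'I_n | `[< H (Xs i w) >]]|.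
  by apply: eq_card => i; rewrite !inE; apply/idP/asboolP.
have up : #|[pred i : 'I_n | dotprod (Xs i w) theta <= t]|%:R <=
    #|[pred i : 'I_n | `[< D k (Xs i w) >]]|%:R :> R by rewrite cH ler_nat card_sub.
have lo : #|[pred i : 'I_n | `[< D k.-1 (Xs i w) >]]|%:R <=
   #|[pred i : 'I_n | dotprod (Xs i w) theta <= t]|%:R :> R by rewrite cH ler_nat card_sub.
have kM1 : (k.-1 <= M)%N by lia.
have hk := hw k kM; have hk1 := hw k.-1 kM1.
have FDk : F t <= k%:R / M%:R.
  rewrite -lee_fin -PD // prob_fineK; last exact: measurable_proj_le.
  apply: le_measure; rewrite ?inE; try exact: measurable_proj_le; try exact: measurable_RV.
  by move=> z /= h; apply: HDk.
have FDk1 : k.-1%:R / M%:R <= F t.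
  rewrite -lee_fin -PD // prob_fineK; last exact: measurable_proj_le.
  apply: le_measure; rewrite ?inE; try exact: measurable_proj_le; try exact: measurable_RV.
  by move=> z /= h; apply: DkH.
have kk : k.-1%:R / M%:R = k%:R / M%:R - M%:R^-1 :> R.
  by rewrite -[in RHS](prednK k0) -natr1 mulrDl mul1r addrK.
rewrite kk in FDk1 hk1.
move: up lo hk hk1; rewrite /empirical_cdf.
set N := #|_|%:R; set U := #|_|%:R; set V := #|_|%:R => up lo.
rewrite !ltr_norml => /andP[_ hk] /andP[hk1 _].
have nX : N = n%:R * (N / n%:R) by rewrite mulrC divfK // gt_eqF.
set a := N / n%:R in nX *; set q := k%:R / M%:R in hk hk1 FDk FDk1.
set m := M%:R^-1 in hk1 FDk1 *.
have h1 : a < q + e by rewrite -(ltr_pM2l n0') -nX; lra.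
have h2 : q - m - e < a by rewrite -(ltr_pM2l n0') -nX; lra.
rewrite ler_norml; apply/andP; split; lra.
Qed.

(** Tied projections lie in a common cell of every grid; the grid can be as fine as desired. *)
Lemma no_ties (n : nat) (delta : R) : 0 < delta ->
  off_small P delta (fun w => forall i j : 'I_n, i != j ->
     dotprod (Xs i w) theta != dotprod (Xs j w) theta).
Proof.
move=> delta0; pose M := (Num.trunc ((n * n)%:R / delta)).+1.
have [D [mD [D0 DM] Dmono PD Ddown]] := @proj_grid M isT.
have := grid_collision hindep hid _ mD DM Dmono PD n; move=> /(_ isT).
apply: off_small_sub.
  rewrite ler_pdivrMr ?ltr0n // mulrC -ler_pdivrMr //.
  exact/ltW/truncnS_gt.
move=> w hw i j ij; apply/eqP => eij.
have [k [Dk nDk]] := exists_cell D0 DM (Xs i w).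
apply: (hw i j ij k); split; split => //.
  by apply: Ddown Dk; rewrite eij.
by move=> h; apply: nDk; apply: Ddown h; rewrite eij.
Qed.

End Projection.

(** * Depth and one-dimensional distribution functions *)

Lemma sin_le_id (R : realType) (x : R) : 0 <= x -> sin x <= x.
Proof.
move=> x0; rewrite -subr_ge0.
pose f (z : R) : R := z - sin z.
suff : f 0 <= f x by rewrite /f sin0 subrr.
by apply: (@ge0_derive_le _ f (fun z => 1 - cos z)) => // z _; rewrite subr_ge0 cos_le1.
Qed.

Lemma cos_ge_quad (R : realType) (x : R) : 0 <= x -> 1 - x ^+ 2 / 2 <= cos x.
Proof.
move=> x0; rewrite -subr_ge0.
pose f (z : R) : R := cos z - (1 - z ^+ 2 / 2).
suff : f 0 <= f x by rewrite /f cos0 expr0n /= mul0r subr0 subrr.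
apply: (@ge0_derive_le _ f (fun z => z - sin z)); [|move=> z /andP[z0 _]; rewrite subr_ge0; exact: sin_le_id|by []].
by move=> z _; rewrite /f; apply: is_derive_eq; rewrite /GRing.scale /=; field.
Qed.

Section Depth.
Context (R : realType) (d : nat) (dT : measure_display)
  (T : measurableType dT) (P : probability T R).
Hypothesis d0 : (0 < d)%N.
Implicit Types (q u theta : 'rV[R]_d).

Lemma halfspace_mem u q (c : R) : u != 0 -> c <= dotprod q u ->
  halfspaces_containing q [set x | c <= dotprod x u].
Proof. by move=> u0 cq; split => //; exists u, c. Qed.

Lemma halfspaces_neq0 q : exists H, halfspaces_containing q H.
Proof.
have u0 : (const_mx 1 : 'rV[R]_d) != 0.
  apply/eqP => /rowP /(_ (Ordinal d0)); rewrite !mxE => /eqP.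
  by rewrite oner_eq0.
by eexists; apply: halfspace_mem u0 (lexx _).
Qed.

(** The chord has square [2 - 2 cos a], where [a] is the angle, and [1 - a^2 / 2 <= cos a]. *)
Lemma chord_le_angle (c theta : 'rV[R]_d) (psi : R) : sphere c -> sphere theta ->
  sphdist c theta <= psi -> enorm (theta - c) <= psi.
Proof.
move=> sc st; rewrite /sphdist => h.
have dc : -1 <= dotprod c theta <= 1.
  by have := cauchy_schwarz c theta; rewrite sc st mulr1 ler_norml.
have a0 : 0 <= acos (dotprod c theta) by exact: acos_ge0.
have := cos_ge_quad a0; rewrite acosK //.
set a := acos _ in h a0 *.
move=> hq; apply: le_trans h.
rewrite -ler_sqr ?nnegrE ?enorm_ge0 // enorm_sqr.
rewrite !(dotprodDl, dotprodDr, dotprodNl, dotprodNr) !sphere_dot // (dotprodC theta c).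
lra.
Qed.

Section Sample.
Variables (n : nat) (x : 'I_n -> 'rV[R]_d).
Hypothesis n0 : (0 < n)%N.

Lemma HD_sample_le q H : halfspaces_containing q H ->
  HD_sample x q <= n%:R^-1 * #|[pred i : 'I_n | `[< H (x i) >]]|%:R.
Proof.
move=> hH; rewrite /HD_sample ler_wpM2l ?invr_ge0 //; apply: ge_inf.
  by exists 0 => _ [H' _ <-].
by exists H.
Qed.

Lemma HD_sample_ge q (c : R) : (forall H, halfspaces_containing q H ->
   c <= n%:R^-1 * #|[pred i : 'I_n | `[< H (x i) >]]|%:R) -> c <= HD_sample x q.
Proof.
move=> h; rewrite /HD_sample mulrC ler_pdivlMr ?ltr0n //.
apply: lb_le_inf.
  by have [H hH] := halfspaces_neq0 q; eexists; exists H.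
move=> _ [H hH <-]; have := h H hH.
by rewrite mulrC ler_pdivlMr ?ltr0n.
Qed.

Lemma HD_sample_ge0 q : 0 <= HD_sample x q.
Proof. by apply: HD_sample_ge => H _; rewrite mulr_ge0 ?invr_ge0. Qed.

End Sample.

Variables (X : {RV P >-> borelRd R d}).

Lemma HD_le q H : halfspaces_containing q H -> HD P X q <= fine (P (X @^-1` H)).
Proof.
move=> hH; apply: ge_inf; last by exists H.
by exists 0 => _ [H' _ <-]; exact: fine_prob_ge0.
Qed.

Lemma HD_ge q (c : R) : (forall H, halfspaces_containing q H ->
   c <= fine (P (X @^-1` H))) -> c <= HD P X q.
Proof.
move=> h; apply: lb_le_inf.
  by have [H hH] := halfspaces_neq0 q; eexists; exists H.
by move=> _ [H hH <-]; exact: h.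
Qed.

Lemma HD_ge0 q : 0 <= HD P X q.
Proof. by apply: HD_ge => H _; exact: fine_prob_ge0. Qed.

(** Reversing the normal turns an upper halfspace into a sublevel set of a projection. *)
Lemma halfspace_direction q H : halfspaces_containing q H -> exists theta t,
  sphere theta /\ H = [set x | dotprod x theta <= t].
Proof.
move=> [[u [c [u0 ->]]] _]; have e0 := enorm_gt0 u0.
exists ((enorm u)^-1 *: (- u)), (- ((enorm u)^-1 * c)); split.
  rewrite scalerN; have := sphere_normalize u0.
  by rewrite /sphere /= /enorm dotprodNl dotprodNr opprK.
apply/seteqP; split => y /=; rewrite dotprodZr dotprodNr mulrN lerN2 ler_pM2l //;
  by rewrite invr_gt0.
Qed.

Lemma HD_deviation_le n (x : 'I_n -> 'rV[R]_d) (eps : R) : (0 < n)%N ->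
  (forall theta t, sphere theta -> `|empirical_cdf x theta t - projection_cdf P X theta t| <= eps) ->
  forall q, `|HD P X q - HD_sample x q| <= eps.
Proof.
move=> n0 h q.
have hH H : halfspaces_containing q H ->
   `|n%:R^-1 * #|[pred i : 'I_n | `[< H (x i) >]]|%:R - fine (P (X @^-1` H))| <= eps.
  move=> /halfspace_direction[theta [t [st ->]]].
  rewrite mulrC; have := h theta t st; rewrite /empirical_cdf /projection_cdf.
  rewrite (eq_card (_ : _ =i [pred i : 'I_n | `[< [set x | dotprod x theta <= t] (x i) >]])) //.
  by move=> i; rewrite !inE; apply/idP/asboolP.
rewrite ler_distl; apply/andP; split.
- apply: HD_ge => H hq; have := hH H hq; have := HD_sample_le x hq.
  by rewrite ler_norml; lra.
- rewrite -lerBlDr; apply: HD_sample_ge => // H hq; have := hH H hq; have := HD_le hq.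
  by rewrite ler_norml; lra.
Qed.

Variables (Lpi Ltheta : R).
Hypotheses (hproj : projection_lipschitz P X Lpi) (hrad : radial_lipschitz P X Ltheta).

(** Each projection of a sample point moves by at most [psi * r], so the empirical
    distribution function at [theta] lies between shifts by [psi * r] of the one at [c];
    the population side pays [Lpi * (psi * r)] for the shift and [Ltheta * psi] for the turn. *)
Lemma direction_transfer n (x : 'I_n -> 'rV[R]_d) (c theta : 'rV[R]_d) (psi r e : R) :
  sphere c -> sphere theta -> sphdist c theta <= psi ->
  0 <= psi -> 0 <= r ->
  (forall i, enorm (x i) <= r) ->
  (forall t, `|empirical_cdf x c t - projection_cdf P X c t| <= e) ->
  forall t, `|empirical_cdf x theta t - projection_cdf P X theta t| <= e + psi * (Ltheta + Lpi * r).
Proof.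
move=> sc st dc psi0 r0 hr he t.
have [Lpi0 hL] := hproj; have [Lt0 hR] := hrad.
have ch := chord_le_angle sc st dc.
have dx i : `|dotprod (x i) theta - dotprod (x i) c| <= r * psi.
  rewrite -dotprodNr -dotprodDr; apply: le_trans (cauchy_schwarz _ _) _.
  by apply: ler_pM; rewrite ?enorm_ge0.
have n0' : 0 <= n%:R^-1 :> R by rewrite invr_ge0.
have up : empirical_cdf x theta t <= empirical_cdf x c (t + r * psi).
  rewrite /empirical_cdf ler_wpM2r // ler_nat; apply: subset_leq_card.
  apply/fintype.subsetP => i; rewrite !inE; have := dx i; rewrite ler_norml; lra.
have lo : empirical_cdf x c (t - r * psi) <= empirical_cdf x theta t.
  rewrite /empirical_cdf ler_wpM2r // ler_nat; apply: subset_leq_card.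
  apply/fintype.subsetP => i; rewrite !inE; have := dx i; rewrite ler_norml; lra.
have := he (t + r * psi); have := he (t - r * psi).
have := hL c sc (t + r * psi) t; have := hL c sc (t - r * psi) t.
have := hR t c theta sc st.
have : Ltheta * sphdist c theta <= Ltheta * psi by rewrite ler_wpM2l.
have rp : 0 <= r * psi by rewrite mulr_ge0.
have e1 : t + r * psi - t = r * psi by ring.
have e2 : t - r * psi - t = - (r * psi) by ring.
rewrite e1 e2 normrN (ger0_norm rp).
rewrite !ler_norml => h1 /andP[h2 h3] /andP[h4 h5] /andP[h6 h7] /andP[h8 h9] /andP[h10 h11].
rewrite (_ : psi * (Ltheta + Lpi * r) = Ltheta * psi + Lpi * (r * psi)); last by ring.
apply/andP; split; lra.
Qed.

(** Opposite halfspaces through [q] share only a hyperplane, which is null since the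
    projections are Lipschitz; one of them has probability at most 1/2. *)
Lemma HD_le_half q (delta : R) : 0 < delta -> HD P X q <= 2^-1 + delta.
Proof.
move=> delta0; have [Lpi0 hL] := hproj.
have [_ [[u [c [u0 _]]] _]] := halfspaces_neq0 q.
pose theta := (enorm u)^-1 *: u; have st : sphere theta := sphere_normalize u0.
have t0 : theta != 0.
  apply/eqP => t0; have := sphere_dot st; rewrite t0 -(scale0r theta) dotprodZl mul0r.
  by move=> /eqP; rewrite eq_sym oner_eq0.
have Nt0 : - theta != 0 by rewrite oppr_eq0.
have h1 := HD_le (halfspace_mem t0 (lexx (dotprod q theta))).
have h2 : HD P X q <= projection_cdf P X theta (dotprod q theta).
  have := HD_le (halfspace_mem Nt0 (lexx (dotprod q (- theta)))).
  rewrite /projection_cdf (_ : _ @^-1` _ = [set w | dotprod (X w) theta <= dotprod q theta]) //.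
  by apply/seteqP; split => w /=; rewrite !dotprodNr lerN2.
(* Moving the threshold below q makes the two halfspaces disjoint, at a cost of delta. *)
pose s := dotprod q theta - delta / Lpi.
have h3 : fine (P (X @^-1` [set x | dotprod q theta <= dotprod x theta])) <=
    1 - projection_cdf P X theta s.
  apply: (@le_trans _ _ (fine (P (~` [set w | dotprod (X w) theta <= s])))).
    apply: fine_prob_mono; first exact: measurable_proj_ge.
      by apply: measurableC; exact: measurable_proj_le.
    move=> w /= hw; apply/negP; rewrite -ltNge /s.
    have : 0 < delta / Lpi by rewrite divr_gt0.
    lra.
  rewrite -lee_fin prob_fineK; last by apply: measurableC; exact: measurable_proj_le.
  rewrite probability_setC; last exact: measurable_proj_le.
  rewrite -prob_fineK; last exact: measurable_proj_le.
  by rewrite -EFinB.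
have := hL theta st (dotprod q theta) s.
have e1 : dotprod q theta - s = delta / Lpi by rewrite /s; ring.
have e2 : Lpi * (delta / Lpi) = delta by rewrite mulrC divfK // gt_eqF.
have e3 : 0 < delta / Lpi by rewrite divr_gt0.
rewrite e1 (gtr0_norm e3) e2 ler_norml => /andP[_ h4].
lra.
Qed.

(** Opposite halfspaces through [q] share at most one sample point when there are no ties,
    so one of them contains at most [(n + 1) / 2] points. *)
Lemma HD_sample_le_half n (x : 'I_n -> 'rV[R]_d) theta q : (0 < n)%N -> sphere theta ->
  (forall i j, i != j -> dotprod (x i) theta != dotprod (x j) theta) ->
  HD_sample x q <= 2^-1 + (2 * n%:R)^-1.
Proof.
move=> n0 st hx; have n0' : 0 < n%:R :> R by rewrite ltr0n.
have t0 : theta != 0.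
  apply/eqP => t0; have := sphere_dot st; rewrite t0 -(scale0r theta) dotprodZl mul0r.
  by move=> /eqP; rewrite eq_sym oner_eq0.
have Nt0 : - theta != 0 by rewrite oppr_eq0.
have h1 := HD_sample_le x (halfspace_mem t0 (lexx (dotprod q theta))).
have h2 := HD_sample_le x (halfspace_mem Nt0 (lexx (dotprod q (- theta)))).
pose A := [pred i : 'I_n | dotprod q theta <= dotprod (x i) theta].
pose B := [pred i : 'I_n | dotprod (x i) theta <= dotprod q theta].
have cA : #|[pred i : 'I_n | `[< [set x | dotprod q theta <= dotprod x theta] (x i) >]]| = #|A|.
  by apply: eq_card => i; rewrite !inE; apply/asboolP/idP.
have cB : #|[pred i : 'I_n | `[< [set x | dotprod q (- theta) <= dotprod x (- theta)] (x i) >]]| = #|B|.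
  by apply: eq_card => i; rewrite !inE /= !dotprodNr lerN2; apply/asboolP/idP.
rewrite cA in h1; rewrite cB in h2.
have AB : (#|A| + #|B| <= n + 1)%N.
  rewrite -cardUI; apply: leq_add; first by rewrite -[leqRHS]card_ord max_card.
  rewrite leqNgt; apply/negP => /card_gt1P[i [j [iAB jAB]]] ij.
  move: iAB jAB; rewrite !inE => /andP[i1 i2] /andP[j1 j2].
  by have := hx i j ij; rewrite eq_le (le_trans i2 j1) (le_trans j2 i1).
have AB' : #|A|%:R + #|B|%:R <= n%:R + 1 :> R by rewrite -natrD -[1]/(1%:R) -natrD ler_nat.
have := ler_wpM2l (_ : 0 <= n%:R^-1) AB'; rewrite invr_ge0 ler0n => /(_ isT).
rewrite !mulrDr mulr1 mulVf ?gt_eqF // => h3.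
rewrite invfM; lra.
Qed.

End Depth.

(** * Reduction of the deviation event to rational points *)

Section RationalPoints.
Variables (R : realType) (d : nat).
Implicit Types (q u v : 'rV[R]_d).

(** Vectors over [rat] rather than a dense subset of the real space: their type is
    countable, so quantifiers over it preserve measurability. *)
Definition rational_vec (a : 'rV[rat]_d) : 'rV[R]_d := map_mx (@ratr R) a.
Local Notation rv := rational_vec.

Definition coord_close (delta : R) q v := forall i, `|q ord0 i - v ord0 i| <= delta.

Lemma rational_close q (delta : R) : 0 < delta -> exists a, coord_close delta q (rv a).
Proof.
move=> delta0.
have ex i : exists r : rat, `|q ord0 i - ratr r| <= delta.
  have [r] := @rat_in_itvoo R (q ord0 i - delta) (q ord0 i + delta) ltac:(lra).
  by rewrite in_itv /= => /andP[h1 h2]; exists r; rewrite ler_norml; lra.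
have [f hf] := choice ex.
by exists (\row_i f i) => i; rewrite !mxE.
Qed.

Lemma rational_dense q (U : set 'rV[R]_d) : nbhs q U -> exists a, U (rv a).
Proof.
move=> /nbhs_ballP[e /= e0 eU].
have [a ha] := @rational_close q (e / 2) ltac:(lra).
exists a; apply: eU; split => // i j; rewrite ord1 /ball /=.
by apply: le_lt_trans (ha j) _; lra.
Qed.

Definition l1norm u : R := \sum_i `|u ord0 i|.

Lemma l1norm_ge0 u : 0 <= l1norm u.
Proof. by apply: sumr_ge0. Qed.

Lemma dotprod_close (delta : R) q v u : coord_close delta q v ->
  `|dotprod q u - dotprod v u| <= delta * l1norm u.
Proof.
move=> h; rewrite -dotprodNl -dotprodDl.
apply: le_trans (ler_norm_sum _ _ _) _; rewrite /l1norm mulr_sumr.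
by apply: ler_sum => i _; rewrite normrM ler_wpM2r // !mxE.
Qed.

Lemma near_dotprod_lt u v (c : R) : dotprod u v < c ->
  \forall w \near u, dotprod w v < c.
Proof. by move=> h; exact: (cvgr_lt _ (@dotprod_continuous R d v u)). Qed.

Lemma near_dotprod_gt u v (c : R) : c < dotprod u v ->
  \forall w \near u, c < dotprod w v.
Proof. by move=> h; exact: (cvgr_gt _ (@dotprod_continuous R d v u)). Qed.

Lemma near_forall_imp (I : finType) (C : pred I) (A : I -> set 'rV[R]_d) v :
  (forall i, C i -> nbhs v (A i)) -> nbhs v (fun w => forall i, C i -> A i w).
Proof.
move=> h; apply: (@filter_forall _ _ (fun i w => C i -> A i w) (nbhs v) (nbhs_filter v)) => i.
case: (boolP (C i)) => [Ci|_].
  by apply: (@filterS _ (nbhs v) (nbhs_filter v) (A i)) => [w|]; last exact: h.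
by apply: (@nearW _ (nbhs v) _ (nbhs_filter v)).
Qed.

Lemma near_continuous_gt (h : 'rV[R]_d -> R) v (c : R) : continuous h -> c < h v ->
  nbhs v [set w | c < h w].
Proof. by move=> hc; exact: (cvgr_gt _ (hc v)). Qed.

Section Sample.
Variables (n : nat) (x : 'I_n -> 'rV[R]_d).
Hypothesis n0 : (0 < n)%N.

(** Number of sample points in the halfspace with inner normal [u] through [q], enlarged
    by the slack [delta * l1norm u].  This slack bounds the change of [<q, u>] when the
    coordinates of [q] move by at most [delta] ([dotprod_close]), so that replacing [q] by a
    nearby rational point loses no sample point. *)
Definition relaxed_count (delta : R) q u : nat :=
  #|[pred i : 'I_n | dotprod q u <= dotprod (x i) u + delta * l1norm u]|.

Lemma relaxed_count_sub (delta delta' : R) q u q' u' :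
  (forall i, dotprod (x i) u + delta * l1norm u < dotprod q u ->
     dotprod (x i) u' + delta' * l1norm u' < dotprod q' u') ->
  (relaxed_count delta' q' u' <= relaxed_count delta q u)%N.
Proof.
move=> h; apply: subset_leq_card; apply/fintype.subsetP => i; rewrite !inE => hi.
by rewrite leNgt; apply/negP => /h; rewrite ltNge hi.
Qed.

Lemma HD_sample_ltP q (c : R) : (0 < d)%N ->
  HD_sample x q < c <-> exists2 u, u != 0 & n%:R^-1 * (relaxed_count 0 q u)%:R < c.
Proof.
move=> d0; split => [h|[u u0]].
  apply: contrapT => nex; move: h; rewrite ltNge => /negP; apply.
  apply: HD_sample_ge => // H [[u [c' [u0 ->]]] /= cq].
  apply: (@le_trans _ _ (n%:R^-1 * (relaxed_count 0 q u)%:R)).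
    by rewrite leNgt; apply/negP => h; apply: nex; exists u.
  rewrite ler_wpM2l ?invr_ge0 // ler_nat; apply: subset_leq_card.
  apply/fintype.subsetP => i; rewrite !inE mul0r addr0 => hi.
  exact: le_trans hi.
apply: le_lt_trans; apply: le_trans (HD_sample_le x (halfspace_mem u0 (lexx (dotprod q u)))) _.
rewrite ler_wpM2l ?invr_ge0 // ler_nat; apply: subset_leq_card.
by apply/fintype.subsetP => i; rewrite !inE mul0r addr0.
Qed.

(** The sample points strictly outside a halfspace stay strictly outside when its normal
    is perturbed and [q] stays on its boundary, being finitely many. *)
Lemma rational_direction q u : u != 0 -> exists b, rv b != 0 /\
  forall i, dotprod (x i) u < dotprod q u -> dotprod (x i) (rv b) < dotprod q (rv b).
Proof.
move=> u0; have uu := dotprod_gt0 u0.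
have [b [b0 hb]] : exists b, 0 < dotprod (rv b) u /\
    forall i, dotprod (x i) u < dotprod q u -> dotprod (x i) (rv b) < dotprod q (rv b).
  apply: (@rational_dense u (fun v => 0 < dotprod v u /\
    forall i, dotprod (x i) u < dotprod q u -> dotprod (x i) v < dotprod q v)).
  apply: (@filterI _ (nbhs u)); first exact: near_dotprod_gt.
  apply: (@near_forall_imp _ (fun i => dotprod (x i) u < dotprod q u)
    (fun i v => dotprod (x i) v < dotprod q v)) => i h.
  have : dotprod u (x i - q) < 0 by rewrite dotprodDr dotprodNr !(dotprodC u) subr_lt0.
  move=> /near_dotprod_lt; apply: filterS => v.
  by rewrite dotprodDr dotprodNr !(dotprodC v) subr_lt0.
exists b; split => //; apply/eqP => rb0; move: b0.
by rewrite rb0 -(scale0r u) dotprodZl mul0r ltxx.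
Qed.

Variable g : 'rV[R]_d -> R.
Hypothesis gcont : continuous g.

(** A halfspace that keeps the excluded sample points strictly outside can be perturbed,
    first in its normal and then in the point [q], to rational data. *)
Lemma depth_below_rational (eps : R) : (0 < d)%N ->
  (exists q, HD_sample x q < g q - eps) <->
  (exists a b, rv b != 0 /\ n%:R^-1 * (relaxed_count 0 (rv a) (rv b))%:R < g (rv a) - eps).
Proof.
move=> d0; split; last first.
  by move=> [a [b [b0 h]]]; exists (rv a); apply/HD_sample_ltP => //; exists (rv b).
move=> [q /(HD_sample_ltP _ _ d0)[u u0 h]].
have [b [b0 hb]] := @rational_direction q u u0.
have [a [ha hg]] : exists a, (forall i, dotprod (x i) (rv b) < dotprod q (rv b) ->
    dotprod (x i) (rv b) < dotprod (rv a) (rv b)) /\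
    n%:R^-1 * (relaxed_count 0 q u)%:R + eps < g (rv a).
  apply: (@rational_dense q (fun v => (forall i, dotprod (x i) (rv b) < dotprod q (rv b) ->
    dotprod (x i) (rv b) < dotprod v (rv b)) /\ n%:R^-1 * (relaxed_count 0 q u)%:R + eps < g v)).
  apply: (@filterI _ (nbhs q)).
    apply: (@near_forall_imp _ (fun i => dotprod (x i) (rv b) < dotprod q (rv b))
      (fun i v => dotprod (x i) (rv b) < dotprod v (rv b))) => i h'.
    exact: near_dotprod_gt.
  by apply: near_continuous_gt gcont _; lra.
exists a, b; split => //; apply: (@le_lt_trans _ _ (n%:R^-1 * (relaxed_count 0 q u)%:R)); last lra.
rewrite ler_wpM2l ?invr_ge0 // ler_nat; apply: relaxed_count_sub => i.
by rewrite !mul0r !addr0 => /hb /ha.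
Qed.

Variable K : R.
Hypothesis K0 : 0 <= K.
Hypothesis glip : forall delta q v, 0 <= delta -> coord_close delta q v ->
  `|g q - g v| <= K * delta.

Let step (m : nat) : R := m.+1%:R^-1.

Lemma l1norm_delta (s : bool) (k : 'I_d) : l1norm ((-1) ^+ s *: delta_mx ord0 k) = 1.
Proof.
rewrite /l1norm (bigD1 k) //= big1 ?addr0.
  by rewrite !mxE !eqxx mulr1 normr_sign.
by move=> i ik; rewrite !mxE eqxx /= (negbTE ik) mulr0 normr0.
Qed.

Lemma dotprod_delta (s : bool) (k : 'I_d) v :
  dotprod v ((-1) ^+ s *: delta_mx ord0 k) = (-1) ^+ s * v ord0 k.
Proof.
rewrite dotprodZr /dotprod (bigD1 k) //= big1 ?addr0.
  by rewrite !mxE !eqxx mulr1.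
by move=> i ik; rewrite !mxE eqxx /= (negbTE ik) mulr0.
Qed.

Lemma rational_delta (s : bool) (k : 'I_d) :
  rv ((-1) ^+ s *: delta_mx ord0 k) = (-1) ^+ s *: delta_mx ord0 k.
Proof.
by apply/rowP => i; rewrite !mxE rmorphM rmorph_sign /= ratr_nat.
Qed.

(** A halfspace orthogonal to a coordinate axis that has some sample point, up to the
    slack, bounds that coordinate of [q].  This keeps the rational approximations in a
    compact box. *)
Lemma relaxed_bounded (delta c : R) q : 0 <= delta <= 1 -> 0 < c ->
  (forall b, rv b != 0 -> c <= n%:R^-1 * (relaxed_count delta q (rv b))%:R) ->
  forall k, `|q ord0 k| <= \sum_i l1norm (x i) + 1.
Proof.
move=> /andP[del0 del1] c0 h k.
have hs (s : bool) : (-1) ^+ s * q ord0 k <= \sum_i l1norm (x i) + 1.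
  have b0 : rv ((-1) ^+ s *: delta_mx ord0 k) != 0.
    rewrite rational_delta; apply/eqP => /(congr1 (@l1norm)); rewrite l1norm_delta.
    rewrite /l1norm big1 => [/eqP|i _]; last by rewrite mxE normr0.
    by rewrite oner_eq0.
  have := h _ b0; rewrite rational_delta => hc.
  have : (0 < relaxed_count delta q ((-1) ^+ s *: delta_mx ord0 k))%N.
    rewrite lt0n; apply/eqP => c00; move: hc; rewrite c00 mulr0; lra.
  move=> /card_gt0P[i]; rewrite inE !dotprod_delta l1norm_delta mulr1 => hi.
  apply: le_trans hi _; apply: lerD => //.
  apply: (@le_trans _ _ (l1norm (x i))).
    apply: (@le_trans _ _ `|x i ord0 k|).
      by apply: le_trans (ler_norm _) _; rewrite normrM normr_sign mul1r.
    by rewrite /l1norm (bigD1 k) //= lerDl sumr_ge0.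
  rewrite (bigD1 i) //= lerDl sumr_ge0 // => j _; exact: l1norm_ge0.
have := hs false; have := hs true; rewrite expr0 expr1 ler_norml; lra.
Qed.

(** From left to right, [q] is approximated within [step m] by a rational point, and the
    relaxed counts dominate the counts at [q].  Conversely the rational points stay in a
    compact box; at a cluster point the slack has disappeared.  A halfspace at the
    cluster point with too few sample points would have a strict gap to the excluded
    ones, and would still have too few at a nearby approximation. *)
Lemma depth_above_compact (c c' : R) : (0 < d)%N -> 0 < c' ->
  (exists q, g q <= c /\ c' <= HD_sample x q) <->
  (forall m, exists a, g (rv a) <= c + K * step m /\
     forall b, rv b != 0 -> c' <= n%:R^-1 * (relaxed_count (step m) (rv a) (rv b))%:R).
Proof.
move=> d0 c'0.
have st0 m : 0 < step m by rewrite invr_gt0 ltr0n.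
have st1 m : step m <= 1 by rewrite invf_le1 ?ltr0n // ler1n.
have stcvg (e : R) : 0 < e -> \forall m \near \oo, step m < e.
  move=> e0; exact: (cvgr_lt _ (@cvg_harmonic R)).
split.
  move=> [q [gq hq]] m; have [a ha] := @rational_close q _ (st0 m).
  exists a; split.
    by have := glip (ltW (st0 m)) ha; rewrite ler_norml; lra.
  move=> b b0; apply: (@le_trans _ _ (n%:R^-1 * (relaxed_count 0 q (rv b))%:R)).
    rewrite leNgt; apply/negP => h.
    by have : HD_sample x q < c' by [apply/HD_sample_ltP => //; exists (rv b)]; lra.
  rewrite ler_wpM2l ?invr_ge0 // ler_nat; apply: relaxed_count_sub => i.
  have := dotprod_close (rv b) ha; rewrite ler_norml; lra.
move=> /choice[a ha]; have K0' := K0.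
pose qs (m : nat) := rv (a m).
pose rho := \sum_i l1norm (x i) + 1.
have bnd m k : `|qs m ord0 k| <= rho.
  apply: (@relaxed_bounded (step m) c') => //; first by rewrite (ltW (st0 m)) st1.
  exact: (ha m).2.
have comp := @rV_compact R d (fun=> `[- rho, rho]%classic) (fun=> @segment_compact R _ _).
have [|q [_ qcl]] := comp (fmap qs \oo) _.
  exists 0%N => // m _ k /=; rewrite in_itv /=.
  by have := bnd m k; rewrite ler_norml.
exists q; split.
  rewrite leNgt; apply/negP => gc.
  have nq : nbhs q [set v | c + (g q - c) / 2 < g v].
    by apply: near_continuous_gt gcont _; lra.
  have ev : (fmap qs \oo) [set v | exists m, v = qs m /\ K * step m < (g q - c) / 2].
    have e0 : 0 < (g q - c) / 2 / (K + 1) by rewrite !divr_gt0 //; lra.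
    have := stcvg _ e0; apply: filterS => m hm; exists m; split => //.
    move: hm; rewrite ltr_pdivlMr; last by lra.
    have := st0 m; nra.
  have [v [[m [-> hm]] /= hg]] := qcl _ _ ev nq.
  have := (ha m).1; rewrite -/(qs m); lra.
rewrite leNgt; apply/negP => /(HD_sample_ltP _ _ d0)[u u0 hu].
have [b [b0 hb]] := @rational_direction q u u0.
(* Half of the gap goes to the displacement of q, half to the slack. *)
pose gap i := (dotprod q (rv b) - dotprod (x i) (rv b)) / 2.
have nq : nbhs q [set v | forall i, dotprod (x i) (rv b) < dotprod q (rv b) ->
    dotprod (x i) (rv b) + gap i < dotprod v (rv b)].
  apply: (@near_forall_imp _ (fun i => dotprod (x i) (rv b) < dotprod q (rv b))
    (fun i v => dotprod (x i) (rv b) + gap i < dotprod v (rv b))) => i h'.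
  by apply: near_dotprod_gt; rewrite /gap; lra.
have ev : (fmap qs \oo) [set v | exists m, v = qs m /\
   forall i, dotprod (x i) (rv b) < dotprod q (rv b) -> step m * l1norm (rv b) < gap i].
  have : \forall m \near \oo, forall i, dotprod (x i) (rv b) < dotprod q (rv b) ->
      step m * l1norm (rv b) < gap i.
    apply: (@filter_forall _ _ (fun i m => dotprod (x i) (rv b) < dotprod q (rv b) -> step m * l1norm (rv b) < gap i)) => i.
    have [h'|_] := boolP (dotprod (x i) (rv b) < dotprod q (rv b)); last by apply: nearW => ? .
    have g0 : 0 < gap i by rewrite /gap; lra.
    have l0 := l1norm_ge0 (rv b).
    have e0 : 0 < gap i / (l1norm (rv b) + 1) by rewrite divr_gt0 //; lra.
    have := stcvg _ e0; apply: filterS => m hm _.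
    move: hm; rewrite ltr_pdivlMr; last by lra.
    have := st0 m; lra.
  by apply: filterS => m hm; exists m.
have [v [[m [-> hm]] /= hv]] := qcl _ _ ev nq.
have := (ha m).2 b b0; rewrite -/(qs m) => hc.
have : (relaxed_count (step m) (qs m) (rv b) <= relaxed_count 0 q u)%N.
  apply: relaxed_count_sub => i; rewrite mul0r addr0 => /hb h.
  by have := hm i h; have := hv i h; lra.
rewrite -(ler_nat R) => hcc.
have := ler_wpM2l (_ : 0 <= n%:R^-1) hcc; rewrite invr_ge0 ler0n => /(_ isT).
lra.
Qed.

End Sample.
End RationalPoints.

(** * Measurability of the deviation event *)

Section Countable.
Context (dT : measure_display) (T : measurableType dT).

Lemma measurable_exists (U : countType) (A : U -> set T) :
  (forall u, measurable (A u)) -> measurable [set w | exists u, A u w].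
Proof.
move=> mA; rewrite (_ : [set w | _] = \bigcup_u A u).
  by apply: countable_bigcupT_measurable => //; exact: countableP.
by apply/seteqP; split => w /= [u]; [exists u|exists u].
Qed.

Lemma measurable_forall (U : countType) (A : U -> set T) :
  (forall u, measurable (A u)) -> measurable [set w | forall u, A u w].
Proof.
move=> mA; rewrite (_ : [set w | _] = ~` [set w | exists u, (~` A u) w]).
  by apply: measurableC; apply: measurable_exists => u; exact: measurableC.
apply/seteqP; split => w /=; first by move=> h [u]; apply.
by move=> h u; apply: contrapT => hu; apply: h; exists u.
Qed.

Lemma measurable_and_const (C : Prop) (A : set T) : measurable A ->
  measurable [set w | C /\ A w].
Proof.
move=> mA; have [c|nc] := pselect C.
  by rewrite (_ : [set w | _] = A) //; apply/seteqP; split => w /=; tauto.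
by rewrite (_ : [set w | _] = set0) //; apply/seteqP; split => w /=; tauto.
Qed.

Lemma measurable_imp_const (C : Prop) (A : set T) : measurable A ->
  measurable [set w | C -> A w].
Proof.
move=> mA; have [c|nc] := pselect C.
  by rewrite (_ : [set w | _] = A) //; apply/seteqP; split => w /=; tauto.
by rewrite (_ : [set w | _] = setT) //; apply/seteqP; split => w /=; tauto.
Qed.

End Countable.

Section DepthEvent.
Context (R : realType) (d : nat) (dT : measure_display)
  (T : measurableType dT) (P : probability T R).
Variables (X : {RV P >-> borelRd R d}) (Xs : nat -> {RV P >-> borelRd R d}).
Variable L : R.
Hypothesis d0 : (0 < d)%N.
Hypothesis hproj : projection_lipschitz P X L.

Lemma l1norm_sphere (theta : 'rV[R]_d) : sphere theta -> l1norm theta <= d%:R.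
Proof.
move=> st; rewrite /l1norm -[leRHS]mulr1.
have -> : d%:R * 1 = \sum_(i < d) (1 : R) by rewrite sumr_const card_ord mulr1.
apply: ler_sum => i _; rewrite -(@ler_sqr R) ?nnegrE // expr1n real_normK ?num_real //.
have := sphere_dot st; rewrite /dotprod (bigD1 i) //= -expr2 => <-.
by rewrite lerDl; apply: sumr_ge0 => j _; rewrite -expr2 sqr_ge0.
Qed.

Lemma HD_lipschitz (delta : R) (q v : 'rV[R]_d) : 0 <= delta -> coord_close delta q v ->
  `|HD P X q - HD P X v| <= L * d%:R * delta.
Proof.
have [L0 hL] := hproj.
have one (p r : 'rV[R]_d) : 0 <= delta -> coord_close delta p r ->
    HD P X p <= HD P X r + L * d%:R * delta.
  move=> del0 hpr; rewrite -lerBlDr; apply: HD_ge => // H hH.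
  have [theta [t [st HE]]] := halfspace_direction hH.
  have rt : dotprod r theta <= t by have := hH.2; rewrite HE.
  pose t' := t + delta * d%:R.
  have pt : dotprod p theta <= t'.
    have := dotprod_close theta hpr; have := l1norm_sphere st => h1.
    have := ler_wpM2l del0 h1; rewrite ler_norml /t'; lra.
  have H'p : halfspaces_containing p [set x | dotprod x theta <= t'].
    split => //; exists (- theta), (- t'); split.
      rewrite oppr_eq0; apply/eqP => t0; have := sphere_dot st.
      rewrite t0 -(scale0r theta) dotprodZl mul0r => /eqP.
      by rewrite eq_sym oner_eq0.
    by apply/seteqP; split => y /=; rewrite dotprodNr lerN2.
  have := HD_le X H'p; have := hL theta st t' t.
  have e1 : t' - t = delta * d%:R by rewrite /t'; ring.
  rewrite e1 (@ger0_norm _ (delta * _)) ?mulr_ge0 // HE /projection_cdf.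
  rewrite -[X @^-1` _]/[set w | dotprod (X w) theta <= t'].
  rewrite -[X @^-1` _]/[set w | dotprod (X w) theta <= t].
  rewrite ler_norml; lra.
move=> del0 hqv; have h1 := one q v del0 hqv.
have hvq : coord_close delta v q by move=> i; rewrite distrC.
have h2 := one v q del0 hvq.
rewrite ler_norml; apply/andP; split; lra.
Qed.

Lemma HD_continuous : continuous (HD P X).
Proof.
have [L0 _] := hproj; have Ld0 : 0 <= L * d%:R by rewrite mulr_ge0 // ltW.
move=> q A /nbhs_ballP[e /= e0 eA].
apply/nbhs_ballP; exists (e / (L * d%:R + 1)); first by rewrite /= divr_gt0 //; lra.
move=> v [_ qv]; apply: eA; have ek0 : 0 <= e / (L * d%:R + 1) by rewrite divr_ge0 //; lra.
have qv' : coord_close (e / (L * d%:R + 1)) q v.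
  by move=> i; apply: ltW; exact: qv.
apply: le_lt_trans (HD_lipschitz ek0 qv') _.
rewrite mulrA ltr_pdivrMr; last by lra.
lra.
Qed.

Variable n : nat.
Hypothesis n0 : (0 < n)%N.

(** The count takes its value through the set of indices that it counts, which ranges
    over a finite type. *)
Lemma measurable_relaxed_count (Q : nat -> Prop) (delta : R) (q u : 'rV[R]_d) :
  measurable [set w | Q (relaxed_count (fun i : 'I_n => Xs i w) delta q u)].
Proof.
rewrite (_ : [set w | _] = [set w | exists J : {set 'I_n}, Q #|J| /\
   forall i : 'I_n, [set w | (i \in J) = (dotprod q u - delta * l1norm u <= dotprod (Xs i w) u)] w]).
  apply: measurable_exists => J; apply: measurable_and_const; apply: measurable_forall => i.
  have mi := measurable_proj_ge (Xs i) u (dotprod q u - delta * l1norm u).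
  case: (i \in J).
    rewrite (_ : [set w | _] = [set w | dotprod q u - delta * l1norm u <= dotprod (Xs i w) u]) //.
    by apply/seteqP; split => w /=; [move=> <-|move=> ->].
  rewrite (_ : [set w | _] = ~` [set w | dotprod q u - delta * l1norm u <= dotprod (Xs i w) u]).
    exact: measurableC.
  by apply/seteqP; split => w /=; [move=> <-|move=> /negP/negbTE ->].
apply/seteqP; split => w /=.
  move=> hQ; exists [set i : 'I_n | dotprod q u <= dotprod (Xs i w) u + delta * l1norm u]%SET.
  split; last by move=> i; rewrite inE lerBlDr.
  by move: hQ; rewrite /relaxed_count cardsE.
move=> [J [hQ hJ]]; move: hQ; rewrite /relaxed_count.
have -> : #|[pred i : 'I_n | dotprod q u <= dotprod (Xs i w) u + delta * l1norm u]| = #|J|.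
  by apply: eq_card => i; rewrite !inE hJ lerBlDr.
by [].
Qed.

(** The complement is the union of the events that some sample depth is too low, or too
    high.  Both reduce to countable combinations of events about relaxed counts. *)
Lemma measurable_depth_event (eps : R) : 0 < eps ->
  measurable [set w | forall q, `|HD P X q - HD_sample (fun i : 'I_n => Xs i w) q| <= eps].
Proof.
move=> eps0; have [L0 _] := hproj.
pose x w (i : 'I_n) : 'rV[R]_d := Xs i w.
pose g := HD P X.
have K0 : 0 <= L * d%:R by rewrite mulr_ge0 // ltW.
pose S1 := [set w | exists q, HD_sample (x w) q < g q - eps].
pose S2 := [set w | exists q, g q + eps < HD_sample (x w) q].
have mS1 : measurable S1.
  rewrite (_ : S1 = [set w | exists a b, rational_vec R b != 0 /\
      n%:R^-1 * (relaxed_count (x w) 0 (rational_vec R a) (rational_vec R b))%:R < g (rational_vec R a) - eps]).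
    apply: measurable_exists => a; apply: measurable_exists => b.
    apply: measurable_and_const.
    exact: (@measurable_relaxed_count (fun k => n%:R^-1 * k%:R < g (rational_vec R a) - eps)).
  by apply/seteqP; split => w /=;
    have [h1 h2] := depth_below_rational (x w) n0 HD_continuous eps d0.
have mS2 : measurable S2.
  (* Two rational levels turn the strict inequality into the two closed conditions of
     depth_above_compact. *)
  have -> : S2 = [set w | exists r r' : rat, (r < r' /\ 0 < @ratr R r') /\
      forall m : nat, exists a : 'rV[rat]_d, g (rational_vec R a) <= @ratr R r - eps + L * d%:R * m.+1%:R^-1 /\
      forall b : 'rV[rat]_d, rational_vec R b != 0 ->
        @ratr R r' <= n%:R^-1 * (relaxed_count (x w) (m.+1%:R^-1) (rational_vec R a) (rational_vec R b))%:R];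
    first last.
    apply: measurable_exists => r; apply: measurable_exists => r'.
    apply: measurable_and_const; apply: measurable_forall => m.
    apply: measurable_exists => a; apply: measurable_and_const.
    apply: measurable_forall => b; apply: measurable_imp_const.
    exact: (@measurable_relaxed_count (fun k => @ratr R r' <= n%:R^-1 * k%:R)).
  apply/seteqP; split => w /=.
    move=> [q hq].
    have [r] := rat_in_itvoo hq; rewrite in_itv /= => /andP[h1 h2].
    have [r'] := rat_in_itvoo h2; rewrite in_itv /= => /andP[h3 h4].
    have g0 : 0 <= g q by exact: HD_ge0.
    exists r, r'; split; first by split; [rewrite -(ltr_rat R)|lra].
    have r'0 : 0 < @ratr R r' by lra.
    apply/(depth_above_compact (x w) n0 HD_continuous K0 HD_lipschitz) => //.
    by exists q; split; [lra|exact: ltW].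
  move=> [r [r' [[rr' r'0] h]]].
  have [q [h1 h2]] := (depth_above_compact (x w) n0 HD_continuous K0 HD_lipschitz
    (ratr r - eps) d0 r'0).2 h.
  exists q; have : @ratr R r < ratr r' by rewrite ltr_rat.
  lra.
rewrite (_ : [set w | _] = ~` (S1 `|` S2)).
  by apply: measurableC; exact: measurableU.
apply/seteqP; split => w /=.
  by move=> h [] [q]; have := h q; rewrite -/(g q) -/(x w) ler_norml; lra.
move=> h q; rewrite -/(g q) -/(x w) ler_norml; apply/andP; split.
  by rewrite leNgt; apply/negP => hq; apply: h; right; exists q; lra.
by rewrite leNgt; apply/negP => hq; apply: h; left; exists q; lra.
Qed.

End DepthEvent.

(** * Constants *)

Section Numerics.
Variable R : realType.

Lemma ln2_ge : 1 / 2 <= ln (2 : R).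
Proof.
have := @ln_le_sub1 R (2^-1) ltac:(lra); rewrite lnV ?posrE //; lra.
Qed.

Lemma ln_of_lnratio (a x : R) : -1 < x < 1 -> a * (1 - x) = 1 + x -> ln a = lnratio x.
Proof.
move=> hx ax; rewrite -lnratioE // -ax mulfK // subr_eq0 eq_sym lt_eqF //.
by case/andP: hx.
Qed.

Lemma ln2_le : ln (2 : R) <= 25 / 36.
Proof.
rewrite (@ln_of_lnratio 2 (1 / 3)); [|lra|lra].
have h := @lnratio_le R (1 / 3) (45 / 100) ltac:(lra) ltac:(lra).
by apply: le_trans h _; lra.
Qed.

Lemma ln54_ge : 223 / 1000 <= ln (5 / 4 : R).
Proof.
rewrite (@ln_of_lnratio (5 / 4) (1 / 9)); [|lra|lra].
have h := @lnratio_ge R (1 / 9) ltac:(lra).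
by apply: le_trans _ h; lra.
Qed.

Lemma ln87_le : ln (8 / 7 : R) <= 67 / 500.
Proof.
rewrite (@ln_of_lnratio (8 / 7) (1 / 15)); [|lra|lra].
have h := @lnratio_le R (1 / 15) (1 / 2) ltac:(lra) ltac:(lra).
by apply: le_trans h _; lra.
Qed.

Lemma sin_ge_cubic (x : R) : 0 <= x -> x - x ^+ 3 / 6 <= sin x.
Proof.
move=> x0; rewrite -subr_ge0.
pose f (z : R) : R := sin z - (z - z ^+ 3 / 6).
suff : f 0 <= f x by rewrite /f sin0 expr0n /= mul0r !subr0.
apply: (@ge0_derive_le _ f (fun z => cos z - (1 - z ^+ 2 / 2))); [|move=> z /andP[z0 _]; rewrite subr_ge0; exact: cos_ge_quad|by []].
by move=> z _; rewrite /f; apply: is_derive_eq; rewrite /GRing.scale /=; field.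
Qed.

Lemma cos_le_quartic (x : R) : 0 <= x -> cos x <= 1 - x ^+ 2 / 2 + x ^+ 4 / 24.
Proof.
move=> x0; rewrite -subr_ge0.
pose f (z : R) : R := (1 - z ^+ 2 / 2 + z ^+ 4 / 24) - cos z.
suff : f 0 <= f x by rewrite /f cos0 !expr0n /= !mul0r subr0 addr0 subrr.
apply: (@ge0_derive_le _ f (fun z => sin z - (z - z ^+ 3 / 6))); [|move=> z /andP[z0 _]; rewrite subr_ge0; exact: sin_ge_cubic|by []].
by move=> z _; rewrite /f; apply: is_derive_eq; rewrite /GRing.scale /=; field.
Qed.

Lemma acos_lt_8_5 (y : R) : 0 <= y <= 1 -> acos y < 8 / 5.
Proof.
move=> /andP[y0 y1]; have y1' : -1 <= y <= 1 by lra.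
have pi2 := @pi_ge2 R.
rewrite -ltr_cos ?in_itv /=; [|by rewrite acos_ge0 // acos_lepi|by lra].
rewrite acosK //; apply: lt_le_trans y0.
have h := @cos_le_quartic (8 / 5) ltac:(lra).
by apply: le_lt_trans h _; lra.
Qed.

Lemma half_lt_acos : 1 / 2 < acos (Num.sqrt 2%:R)^-1 :> R.
Proof.
have s0 : 0 < Num.sqrt 2%:R :> R by rewrite sqrtr_gt0.
have s1 : 4 / 3 <= Num.sqrt 2%:R :> R.
  have -> : 4 / 3 = Num.sqrt ((4 / 3) ^+ 2) :> R by rewrite sqrtr_sqr ger0_norm //; lra.
  by rewrite ler_sqrt; lra.
have y0 : 0 <= (Num.sqrt 2%:R)^-1 :> R by rewrite invr_ge0 ltW.
have y1 : (Num.sqrt 2%:R)^-1 <= 3 / 4 :> R.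
  by rewrite -[leRHS]invrK lef_pV2 ?posrE //; lra.
have y1' : -1 <= (Num.sqrt (2%:R : R))^-1 <= 1 by lra.
have pi2 := @pi_ge2 R.
rewrite -ltr_cos ?in_itv /=; [|by lra|by rewrite acos_ge0 // acos_lepi].
rewrite acosK //.
have h := @cos_ge_quad R (1 / 2) ltac:(lra).
by apply: lt_le_trans _ h; lra.
Qed.

Lemma sphere_point d : (0 < d)%N -> exists u : 'rV[R]_d, sphere u.
Proof.
move=> d0; have [_ [[u [c [u0 _]]] _]] := @halfspaces_neq0 R d d0 0.
by eexists; exact: sphere_normalize u0.
Qed.

Lemma covering_size (C2 psi : R) d : spherical_covering_constant C2 -> (1 < d)%N ->
  0 < psi -> psi < acos (Num.sqrt d%:R)^-1 ->
  1 <= C2 * (Num.sqrt d%:R / psi) ^+ (d - 1) * (d - 1)%:R `^ (3 / 2) * ln d%:R.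
Proof.
move=> [_ hC] d1 psi0 psi1; have [s [_ hs cov]] := hC d psi d1 psi0 psi1.
have [u su] := @sphere_point d (ltnW d1).
have [c cs _] := cov u su.
apply: le_trans hs; rewrite -[1]/(1%:R) ler_nat.
by case: s cs {cov}.
Qed.

(** Any covering of the circle by arcs of radius 1/2 has at least one arc, while
    [2 * sqrt 2 * ln 2 <= 2]. *)
Lemma covering_constant_ge (C2 : R) : spherical_covering_constant C2 -> 1 / 2 <= C2.
Proof.
move=> hC; have C20 : 0 < C2 by case: hC.
have := @covering_size C2 (1 / 2) 2 hC isT _ half_lt_acos.
rewrite subn1 /= powR1 mulr1 expr1 => /(_ ltac:(lra)).
have s1 : Num.sqrt 2%:R <= 142 / 100 :> R.
  have -> : 142 / 100 = Num.sqrt ((142 / 100) ^+ 2) :> R.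
    by rewrite sqrtr_sqr ger0_norm //; lra.
  by rewrite ler_sqrt; lra.
have s0 : 0 < Num.sqrt 2%:R :> R by rewrite sqrtr_gt0.
have l2 := ln2_le; have l1 := ln2_ge.
have : Num.sqrt 2%:R / (1 / 2) * ln 2 <= 2 :> R.
  have : Num.sqrt 2%:R * ln 2 <= 142 / 100 * (25 / 36) :> R.
    by apply: ler_pM => //; lra.
  lra.
rewrite -mulrA => h h1.
have := ler_wpM2l (ltW C20) h; lra.
Qed.

(** Tangent to the logarithm in the variable [7 / d].  The base point 7 is chosen so that
    the coefficient of [d - 1] in [tail_constant] stays positive. *)
Lemma ln_nat_ge (d : nat) : (0 < d)%N -> 1 + ln 7 - 7 / d%:R <= ln (d%:R : R).
Proof.
move=> d0; have d0' : 0 < d%:R :> R by rewrite ltr0n.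
have := @ln_le_sub1 R (7 / d%:R) ltac:(by rewrite divr_gt0).
rewrite ln_div ?posrE //; lra.
Qed.

(** Uses [C2 >= 1/2], [ln d >= 1/2] and [psi < acos (d^(-1/2)) < 8/5]; the power of
    [d - 1] is at least 1. *)
Lemma ln_covering_bound_ge (C2 psi : R) d : spherical_covering_constant C2 -> (1 < d)%N ->
  0 < psi -> psi < acos (Num.sqrt d%:R)^-1 ->
  (d - 1)%:R * (ln d%:R / 2 - ln (8 / 5)) - ln 2 <=
  ln (2 * (C2 * (Num.sqrt d%:R / psi) ^+ (d - 1) * (d - 1)%:R `^ (3 / 2) * ln d%:R)).
Proof.
move=> hC d1 psi0 psi1.
have d2 : 2 <= d%:R :> R by rewrite ler_nat.
have sd1 : 1 <= Num.sqrt d%:R :> R by rewrite -[leLHS]sqrtr1 ler_sqrt //; lra.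
have sd0 : 0 < Num.sqrt d%:R :> R by lra.
have C2h := covering_constant_ge hC.
have psi85 : psi < 8 / 5.
  apply: lt_trans psi1 _; apply: acos_lt_8_5.
  by rewrite invr_ge0 (ltW sd0) /= invf_le1.
have lnd : 1 / 2 <= ln (d%:R : R).
  by apply: le_trans ln2_ge _; rewrite ler_ln ?posrE //; lra.
have pw : 1 <= (d - 1)%:R `^ (3 / 2) :> R.
  have d11 : 1 <= (d - 1)%:R :> R by rewrite ler1n subn_gt0.
  have r32 : 1 <= 3 / 2 :> R by lra.
  exact: le_trans d11 (le1r_powR d11 r32).
pose q : R := (Num.sqrt d%:R / (8 / 5)) ^+ (d - 1).
have q0 : 0 < q by rewrite exprn_gt0 // divr_gt0 //; lra.
have qq : q <= (Num.sqrt d%:R / psi) ^+ (d - 1).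
  rewrite /q lerXn2r ?nnegrE ?divr_ge0 //; try lra.
  by rewrite ler_pM2l // lef_pV2 ?posrE //; lra.
have : q / 2 <= 2 * (C2 * (Num.sqrt d%:R / psi) ^+ (d - 1) * (d - 1)%:R `^ (3 / 2) * ln d%:R).
  have h1 : 1 / 2 * q <= C2 * (Num.sqrt d%:R / psi) ^+ (d - 1) by apply: ler_pM => //; lra.
  have h2 : 1 / 2 * q * 1 <= C2 * (Num.sqrt d%:R / psi) ^+ (d - 1) * (d - 1)%:R `^ (3 / 2).
    by apply: ler_pM => //; lra.
  have h3 : 1 / 2 * q * 1 * (1 / 2) <=
      C2 * (Num.sqrt d%:R / psi) ^+ (d - 1) * (d - 1)%:R `^ (3 / 2) * ln d%:R.
    by apply: ler_pM => //; lra.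
  lra.
move=> hA; apply: (@le_trans _ _ (ln (q / 2))); last first.
  rewrite ler_ln ?posrE //; first by lra.
  by apply: lt_le_trans hA; lra.
have p85 : 0 < 8 / 5 :> R by lra.
have pd : 0 < Num.sqrt d%:R / (8 / 5) :> R by rewrite divr_gt0.
rewrite (ln_div (x := q)) ?posrE // /q lnXn // (ln_div (x := Num.sqrt d%:R)) ?posrE //.
have -> : ln (Num.sqrt d%:R) = ln d%:R / 2 :> R.
  have : ln (Num.sqrt d%:R ^+ 2) = ln d%:R :> R by rewrite sqr_sqrtr //; lra.
  by rewrite lnXn // => <-; rewrite mulr2n; lra.
by rewrite mulr_natl.
Qed.

Lemma natr_exponent (d : nat) : (1 < d)%N ->
  (3 * d - 5)%:R = 3 * (d%:R - 1) - 2 :> R.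
Proof.
move=> d1; have k5 : (3 * d - 5 + 5 = 3 * d)%N by lia.
have : (3 * d - 5)%:R + 5%:R = 3%:R * d%:R :> R by rewrite -natrD k5 natrM.
move: ((3 * d - 5)%:R) => k; lra.
Qed.

(** The left side grows like [(40/7)^(3d)] and the right side like [d^(21 d / 8)] since
    [lnA] is at least of order [(d / 2) ln d]; the constant [4 + 21] that [y >= 4 + lnA]
    leaves in the exponent covers the small [d]. *)
Lemma tail_constant (lnA y : R) (d n : nat) : (1 < d)%N -> (7 <= n)%N ->
  (d - 1)%:R * (ln d%:R / 2 - ln (8 / 5)) - ln 2 <= lnA ->
  4 + lnA <= y ->
  (5 * (n%:R + 1) / n%:R) ^+ (3 * d - 5) <= expR (4 + 21 / 4 * y).
Proof.
move=> d1 n7 hA hy.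
have n7' : 7 <= n%:R :> R by rewrite ler_nat.
have g1 : 5 * (n%:R + 1) / n%:R <= 40 / 7 :> R by rewrite ler_pdivrMr; lra.
have g0 : 0 <= 5 * (n%:R + 1) / n%:R :> R by rewrite divr_ge0 //; lra.
apply: (@le_trans _ _ ((40 / 7) ^+ (3 * d - 5))).
  by rewrite lerXn2r ?nnegrE //; lra.
have p407 : 0 < 40 / 7 :> R by lra.
rewrite -[X in X ^+ _](lnK (x := 40 / 7)) ?posrE // -expRM_natl ler_expR.
(* All logarithms are expressed through ln 2, ln (5 / 4) and ln (8 / 7). *)
have e407 : ln (40 / 7 : R) = 2 * ln 2 + ln (5 / 4) + ln (8 / 7).
  rewrite (_ : 40 / 7 = 2 ^+ 2 * (5 / 4) * (8 / 7)); last by field.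
  by rewrite !lnM ?posrE; lra.
have e85 : ln (8 / 5 : R) = ln 2 - ln (5 / 4).
  by rewrite -ln_div ?posrE; [congr ln; field|lra|lra].
have e7 : ln (7 : R) = 3 * ln 2 - ln (8 / 7).
  have e : 7 = 2 * 2 * 2 / (8 / 7) :> R by field.
  by rewrite {1}e ln_div ?posrE ?lnM ?posrE; lra.
have l2 := ln2_le; have l2' := ln2_ge; have l54 := ln54_ge; have l87 := ln87_le.
have lnd := @ln_nat_ge d (ltnW d1); rewrite e7 in lnd.
have d2 : 2 <= d%:R :> R by rewrite ler_nat.
have dN : (d - 1)%:R = d%:R - 1 :> R by rewrite natrB // ltnW.
have kN := natr_exponent d1.
rewrite dN e85 in hA; rewrite kN e407.
set D := d%:R - 1 in hA *.
have D0 : 0 <= D by rewrite /D; lra.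
have hD : D * (1 + (3 * ln 2 - ln (8 / 7)) - 7 / d%:R) <= D * ln d%:R by rewrite ler_wpM2l.
have dd : D * (7 / d%:R) <= 7.
  by rewrite mulrA ler_pdivrMr; [rewrite /D; lra|lra].
set l := ln 2 in e407 e85 e7 l2 l2' hA lnd hD *.
set a := ln (5 / 4) in e407 e85 l54 hA *.
set b := ln (8 / 7) in e407 e7 l87 lnd hD *.
(* The coefficient of d - 1 in the difference of the two exponents. *)
have key : 0 <= D * (21 / 8 + 9 / 4 * a - 27 / 8 * l - 45 / 8 * b) by rewrite mulr_ge0 //; lra.
have a0 : 0 <= a by lra.
have b0 : 0 <= b by apply: ln_ge0; lra.
lra.
Qed.

End Numerics.

(** * Assembly *)

Section Assembly.
Context (R : realType) (d : nat) (dT : measure_display)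
  (T : measurableType dT) (P : probability T R).
Variables (X : {RV P >-> borelRd R d}) (Xs : nat -> {RV P >-> borelRd R d}).
Hypothesis d0 : (0 < d)%N.
Hypothesis hindep : independent_seq Xs.
Hypothesis hid : forall i, same_distribution (Xs i) X.
Variables (lambda C1 Lpi Ltheta : R).
Hypothesis hdecay : decay_rate P X lambda C1.
Hypothesis hproj : projection_lipschitz P X Lpi.
Hypothesis hrad : radial_lipschitz P X Ltheta.
Variable n : nat.
Hypothesis n0 : (0 < n)%N.

Lemma sample_tail (r : R) : 1 < r ->
  off_small P (n%:R * (C1 * r ^+ (3 * d - 5) * expR (- (lambda * r ^+ 2 / 2))))
    (fun w => forall i : 'I_n, enorm (Xs i w) <= r).
Proof.
move=> r1; have [_ _ hd] := hdecay.
have r0 : 0 <= r by lra.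
have := @off_small_all R dT T P _ (enum 'I_n)
  (C1 * r ^+ (3 * d - 5) * expR (- (lambda * r ^+ 2 / 2))) (fun i w => enorm (Xs i w) <= r).
have h (i : 'I_n) : i \in enum 'I_n -> off_small P (C1 * r ^+ (3 * d - 5) *
    expR (- (lambda * r ^+ 2 / 2))) (fun w => enorm (Xs i w) <= r).
  move=> _; exists (Xs i @^-1` [set x | r < enorm x]); split.
  - by apply: measurable_RV; exact: measurable_enorm_gt.
  - have mA := @measurable_enorm_gt R d r r0.
    by rewrite (same_prob hid i mA); apply: ltW; exact: hd.
  - by move=> w /= /negP; rewrite -leNgt.
move=> /(_ h); apply: off_small_sub; first by rewrite size_enum_ord.
by move=> w hw i; apply: hw; rewrite mem_enum.
Qed.

Lemma depth_deviation (s : seq 'rV[R]_d) (psi r e : R) (M : nat) :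
  (forall c, c \in s -> sphere c) ->
  (forall theta, sphere theta -> exists2 c, c \in s & sphdist c theta <= psi) ->
  0 <= psi -> 1 < r -> (0 < M)%N -> 0 < e -> 7 * e <= 4 ->
  off_small P ((size s)%:R * (4 * expR (- (2 * n%:R * e ^+ 2))) +
      n%:R * (C1 * r ^+ (3 * d - 5) * expR (- (lambda * r ^+ 2 / 2))))
    (fun w => forall q, `|HD P X q - HD_sample (fun i : 'I_n => Xs i w) q| <=
       e + M%:R^-1 + psi * (Ltheta + Lpi * r)).
Proof.
move=> ss cov psi0 r1 M0 e0 e47.
have hs := @off_small_all R dT T P _ s _ _ (fun c cs =>
  dkw_projection hindep hid hproj (ss c cs) n0 M0 e0 e47).
apply: off_small_sub (off_small_and hs (sample_tail r1)) => // w [hc hr].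
apply: HD_deviation_le => // theta t st.
have [c cs hct] := cov theta st.
apply: (direction_transfer hproj hrad (ss c cs) st hct psi0 _ hr); first by lra.
move=> u; exact: (hc c cs u).
Qed.

(** Two numbers in [0, eps] differ by at most [eps]. *)
Lemma depth_half (eps delta : R) : 2^-1 + (2 * n%:R)^-1 <= eps -> 0 < delta ->
  off_small P delta (fun w => forall q,
    `|HD P X q - HD_sample (fun i : 'I_n => Xs i w) q| <= eps).
Proof.
move=> heps delta0; have [u su] := @sphere_point R d d0.
have n0' : 0 < n%:R :> R by rewrite ltr0n.
apply: off_small_sub (no_ties hindep hid hproj su n delta0) => // w hw q.
have h1 := HD_sample_le_half q n0 su hw.
have h2 := HD_sample_ge0 d0 (fun i : 'I_n => Xs i w) n0 q.
have d1 : 0 < (2 * n%:R)^-1 :> R by rewrite invr_gt0 mulr_gt0.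
have h3 := HD_le_half d0 hproj q d1.
have h4 := HD_ge0 d0 X q.
rewrite ler_norml; apply/andP; split; lra.
Qed.

End Assembly.

Lemma powR_three_halves (R : realType) (a : R) : 0 <= a -> a `^ (3 / 2) = a * Num.sqrt a.
Proof.
move=> a0; have -> : 3 / 2 = 1 + 2^-1 :> R by field.
rewrite powRD; last by apply/implyP => /eqP; lra.
by rewrite powRr1 // powR12_sqrt.
Qed.

(** The deviation [e] is shortened by [b = 5 e / (2 N) + 1 / (100 N)], for the net and for
    the grid.  This costs at most [4 N e b = 10 e^2 + e / 25] in the exponent, which with
    the factor [4 = 2 exp (ln 2)] stays below 4 when [e <= 4/7]. *)
Lemma expR_budget (R : realType) (N e : R) : 7 <= N -> 0 < e -> 7 * e <= 4 ->
  4 * expR (- (2 * N * (e - 5 / 2 * e / N - (100 * N)^-1) ^+ 2)) <=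
  2 * expR 4 * expR (- (2 * N * e ^+ 2)).
Proof.
move=> N7 e0 e47.
have N0 : 0 < N by lra.
have l2 := @ln2_le R.
have e2 : 2 = expR (ln 2) :> R by rewrite lnK // posrE.
have -> : 4 = 2 * expR (ln 2) :> R by rewrite -e2; ring.
rewrite -[leLHS]mulrA -[leRHS]mulrA ler_pM2l // -!expRD ler_expR.
have -> : (100 * N)^-1 = 1 / 100 / N by rewrite invfM mul1r.
set b := 5 / 2 * e / N + 1 / 100 / N.
have bN : N * b = 5 / 2 * e + 1 / 100 by rewrite /b; field; rewrite gt_eqF.
have -> : e - 5 / 2 * e / N - 1 / 100 / N = e - b by rewrite /b; ring.
have b2 : 0 <= N * b ^+ 2 by rewrite mulr_ge0 ?sqr_ge0 // ltW.
have -> : 2 * N * (e - b) ^+ 2 = 2 * N * e ^+ 2 - 4 * e * (N * b) + 2 * (N * b ^+ 2) by ring.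
rewrite bN; nra.
Qed.

(** For [n <= 6] the two bounds on [eps] contradict each other, since
    [(n + 1)^2 / (2 n) <= 9/2] is equivalent to [n^2 - 7 n + 1 <= 0], which holds from 1 to 6.
    For [n >= 7] the first bound gives [eps < 1/2 + 1/14 = 4/7]. *)
Lemma sample_size_ge7 (R : realType) (n : nat) (eps : R) : (0 < n)%N -> 0 < eps ->
  eps < 2^-1 + (2 * n%:R)^-1 -> 9 / 2 < 2 * n%:R * eps ^+ 2 ->
  (7 <= n)%N /\ 7 * eps <= 4.
Proof.
rewrite -(ler_nat R 1 n); case: (leqP 7 n) => [|n6].
  rewrite -(ler_nat R 7 n); move: (n%:R : R) => N N7 _ eps0 hsmall _; split => //.
  have N2 : 0 < 2 * N by lra.
  have : 2 * N * eps < N + 1.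
    move: hsmall; rewrite -(ltr_pM2l N2) mulrDr mulfV ?gt_eqF //; lra.
  have : 7 * eps <= 4 \/ 4 < 7 * eps by case: (lerP (7 * eps) 4); [left|right].
  case=> // h.
  have : 2 * N * 4 < 2 * N * (7 * eps) by rewrite ltr_pM2l.
  lra.
have : n%:R <= 6 :> R by rewrite (ler_nat R n 6).
move: (n%:R : R) => N N6 N1 eps0 hsmall h; exfalso.
have N2 : 0 < 2 * N by lra.
have eps1 : 2 * N * eps < N + 1.
  move: hsmall; rewrite -(ltr_pM2l N2) mulrDr mulfV ?gt_eqF //; lra.
have h1 : (2 * N * eps) ^+ 2 <= (N + 1) ^+ 2.
  have e0 : 0 <= 2 * N * eps by rewrite mulr_ge0 ?ltW.
  by rewrite lerXn2r ?nnegrE //; lra.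
have h2 : 2 * N * (9 / 2) < 2 * N * (2 * N * eps ^+ 2) by rewrite ltr_pM2l.
have h3 : 0 <= (N - 1) * (6 - N) by rewrite mulr_ge0 //; lra.
lra.
Qed.

(** The factor [(5 / 2) * ((N + 1) / N)] between the sample radius and [R0] is at least 1, so
    it may be taken out of the whole sum. *)
Lemma net_error (R : realType) (N eps Lt Lp R0 : R) : 0 < N -> 0 < eps -> 0 <= Lt ->
  0 < Lp -> 0 < R0 ->
  eps / (N + 1) / (Lt + Lp * R0) * (Lt + Lp * (5 / 2 * ((N + 1) / N) * R0)) <=
  5 / 2 * eps / N.
Proof.
move=> N0 eps0 Lt0 Lp0 R00.
have LR : 0 < Lp * R0 by rewrite mulr_gt0.
have S0 : 0 < Lt + Lp * R0 by rewrite ltr_wpDl.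
have q1 : 1 <= (N + 1) / N by rewrite ler_pdivlMr //; lra.
have q2 : Lt * 1 <= Lt * (5 / 2 * ((N + 1) / N)) by rewrite ler_wpM2l //; lra.
have h1 : Lt + Lp * (5 / 2 * ((N + 1) / N) * R0) <= 5 / 2 * ((N + 1) / N) * (Lt + Lp * R0).
  lra.
apply: (@le_trans _ _ (eps / (N + 1) / (Lt + Lp * R0) *
    (5 / 2 * ((N + 1) / N) * (Lt + Lp * R0)))).
  by rewrite ler_wpM2l // !divr_ge0 //; lra.
rewrite le_eqVlt; apply/orP; left; apply/eqP; field.
by do ![apply/andP; split]; apply/eqP; lra.
Qed.

Lemma deviation_range (R : realType) (N eps : R) : 7 <= N -> 0 < eps -> 7 * eps <= 4 ->
  9 / 2 < 2 * N * eps ^+ 2 ->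
  0 < eps - 5 / 2 * eps / N - (100 * N)^-1 /\
  7 * (eps - 5 / 2 * eps / N - (100 * N)^-1) <= 4.
Proof.
move=> N7 eps0 eps47 h; have N0 : 0 < N by lra.
have a0 : 0 <= 5 / 2 * eps / N by rewrite divr_ge0 //; lra.
have b0 : 0 <= (100 * N)^-1 by rewrite invr_ge0; lra.
split; last by lra.
rewrite -(pmulr_rgt0 _ N0).
have -> : N * (eps - 5 / 2 * eps / N - (100 * N)^-1) = N * eps - 5 / 2 * eps - 1 / 100.
  by field; apply/eqP; lra.
have Ne : 0 < N * eps by rewrite mulr_gt0.
have : N * eps * (2 * eps) <= N * eps * (8 / 7) by rewrite ler_pM2l //; lra.
lra.
Qed.

Lemma radius_rescaled (R : realType) (N eps sl : R) : 0 < N -> 0 < sl ->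
  5 * eps * Num.sqrt N / sl =
  5 / 2 * ((N + 1) / N) * (2 * eps * N `^ (3 / 2) / (sl * (N + 1))).
Proof.
move=> N0 sl0; rewrite powR_three_halves ?(ltW N0) //; move: (Num.sqrt N) => h.
by field; do ![apply/andP; split]; apply/eqP; lra.
Qed.

Lemma covering_base (R : realType) (N eps sl Lt Lp w sd : R) : 0 < N -> 0 < eps ->
  0 < sl -> 0 < Lt + Lp * (2 * eps * w / (sl * (N + 1))) ->
  (Lt * sl * (N + 1) + 2 * Lp * w * eps) * sd / (eps * sl) =
  sd / (eps / (N + 1) / (Lt + Lp * (2 * eps * w / (sl * (N + 1))))).
Proof.
move=> N0 eps0 sl0; set S := Lt + _ => S0.
have -> : Lt * sl * (N + 1) + 2 * Lp * w * eps = sl * (N + 1) * S.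
  by rewrite /S; field; apply/andP; split; apply/eqP; lra.
by clearbody S; field; do ![apply/andP; split]; apply/eqP; lra.
Qed.

(** With [rho] the base of the power in [B], the radius is [5 (n + 1) / n * sqrt n * rho],
    and [n * (sqrt n)^(3d - 5)] is the power of [n] in [B]; the powers of
    [5 (n + 1) / n] go into the surplus [exp (- (25/2 - 2) n eps^2)] of the tail. *)
Lemma tail_budget (R : realType) (n d : nat) (lambda C1 eps lnA : R) :
  (1 < d)%N -> (7 <= n)%N -> 0 < lambda -> 0 < C1 -> 0 < eps ->
  (d - 1)%:R * (ln d%:R / 2 - ln (8 / 5)) - ln 2 <= lnA ->
  4 + lnA <= 2 * n%:R * eps ^+ 2 ->
  n%:R * (C1 * (5 * eps * Num.sqrt n%:R / Num.sqrt lambda) ^+ (3 * d - 5) *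
    expR (- (lambda * (5 * eps * Num.sqrt n%:R / Num.sqrt lambda) ^+ 2 / 2))) <=
  C1 * (eps * n%:R / (Num.sqrt lambda * (n%:R + 1))) ^+ (3 * d - 5) *
    n%:R `^ (3 / 2 * (d - 1)%:R) * expR 4 * expR (- (2 * n%:R * eps ^+ 2)).
Proof.
move=> d1 n7 lam0 C10 eps0 hA nontriv.
have gammaE := tail_constant d1 n7 hA nontriv.
have N7 : 7 <= n%:R :> R by rewrite ler_nat.
move: (n%:R : R) N7 nontriv gammaE => N N7 {hA n7} _ gammaE; have N0 : 0 < N by lra.
have sl0 : 0 < Num.sqrt lambda by rewrite sqrtr_gt0.
have slE : Num.sqrt lambda ^+ 2 = lambda by rewrite sqr_sqrtr // ltW.
have expo : lambda * (5 * eps * Num.sqrt N / Num.sqrt lambda) ^+ 2 / 2 =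
    25 / 2 * N * eps ^+ 2.
  have -> : lambda * (5 * eps * Num.sqrt N / Num.sqrt lambda) ^+ 2 / 2 =
      lambda / Num.sqrt lambda ^+ 2 * (25 / 2 * Num.sqrt N ^+ 2 * eps ^+ 2).
    by field; apply/eqP; lra.
  by rewrite slE divff ?gt_eqF // mul1r sqr_sqrtr // ltW.
have powE : N `^ (3 / 2 * (d - 1)%:R) = N * Num.sqrt N ^+ (3 * d - 5).
  rewrite powRrM powR_mulrn ?powR_ge0 // powR_three_halves ?(ltW N0) //.
  have {1 3}-> : N = Num.sqrt N ^+ 2 by rewrite sqr_sqrtr // ltW.
  by rewrite -exprSr -exprM -exprD; congr (_ ^+ _); lia.
rewrite powE expo.
set h := Num.sqrt N; have h0 : 0 <= h by exact: sqrtr_ge0.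
set sl := Num.sqrt lambda in sl0 *; clearbody h sl.
have -> : 5 * eps * h / sl = 5 * (N + 1) / N * (h * (eps * N / (sl * (N + 1)))).
  by field; do ![apply/andP; split]; apply/eqP; lra.
have rho0 : 0 <= eps * N / (sl * (N + 1)).
  by apply: divr_ge0; apply: mulr_ge0; lra.
rewrite (exprMn _ (5 * (N + 1) / N)) (exprMn _ h).
have -> : expR (- (25 / 2 * N * eps ^+ 2)) =
   expR (- (4 + 21 / 4 * (2 * N * eps ^+ 2))) * expR 4 * expR (- (2 * N * eps ^+ 2)).
  by rewrite -!expRD; congr expR; field.
rewrite (expRN (4 + _)).
set g := (5 * (N + 1) / N) ^+ _ in gammaE *; set G := expR (4 + _) in gammaE *.
set k1 := h ^+ _; set k2 := (eps * N / _) ^+ _; set x1 := expR 4; set x2 := expR (- _).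
have G0 : 0 < G by exact: expR_gt0.
have gG : g / G <= 1 by rewrite ler_pdivrMr // mul1r.
have c0 : 0 <= N * C1 * k1 * k2 * x1 * x2.
  by rewrite !mulr_ge0 ?expR_ge0 ?exprn_ge0 // ltW.
have -> : N * (C1 * (g * (k1 * k2)) * (G^-1 * x1 * x2)) =
  N * C1 * k1 * k2 * x1 * x2 * (g / G) by ring.
have -> : C1 * k2 * (N * k1) * x1 * x2 = N * C1 * k1 * k2 * x1 * x2 * 1 by ring.
by rewrite ler_wpM2l.
Qed.

Theorem theorem4p8 (R : realType) (d : nat) (hd : (1 < d)%N)
  (dT : measure_display) (T : measurableType dT) (P : probability T R)
  (X : {RV P >-> borelRd R d}) (lambda C1 Lpi Ltheta C2 : R)
  (hdecay : decay_rate P X lambda C1)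
  (hproj : projection_lipschitz P X Lpi)
  (hrad : radial_lipschitz P X Ltheta)
  (Xs : nat -> {RV P >-> borelRd R d})
  (hindep : independent_seq Xs)
  (hid : forall i, same_distribution (Xs i) X)
  (hC2 : spherical_covering_constant C2)
  (n : nat) (hn : (1 <= n)%N) (eps : R) (heps : 0 < eps)
  (hpsi : eps * (n%:R + 1)^-1 *
      (Ltheta + Lpi * eps *
        (2 * n%:R `^ (3 / 2) / (Num.sqrt lambda * (n%:R + 1))))^-1 <
    acos (Num.sqrt d%:R)^-1)
  (hlarge : Num.sqrt lambda * (n%:R + 1) < 2 * eps * n%:R `^ (3 / 2)) :
  let A := 2 * C2 *
    ((Ltheta * Num.sqrt lambda * (n%:R + 1) + 2 * Lpi * n%:R `^ (3 / 2) * eps) *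
       Num.sqrt d%:R / (eps * Num.sqrt lambda)) ^+ (d - 1) *
    (d - 1)%:R `^ (3 / 2) * ln d%:R in
  let B := C1 *
    (eps * n%:R / (Num.sqrt lambda * (n%:R + 1))) ^+ (3 * d - 5) *
    n%:R `^ (3 / 2 * (d - 1)%:R) in
  let E := [set w : T |
    (ereal_sup [set `|HD P X q - HD_sample (fun i : 'I_n => Xs i w) q|%:E
                 | q in [set: 'rV[R]_d]] <= eps%:E)%E] in
  measurable E /\
  ((1 - (A + B) * expR 4 * expR (- (2 * n%:R * eps ^+ 2)))%:E <= P E)%E.
Proof.
move=> A B E.
have d0 : (0 < d)%N by exact: ltnW.
have EE : E = [set w | forall q, `|HD P X q - HD_sample (fun i : 'I_n => Xs i w) q| <= eps].
  apply/seteqP; split => w /=.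
    move=> hw q; rewrite -lee_fin; apply: le_trans hw.
    by apply: ereal_sup_ubound; exists q.
  by move=> hw; apply: ge_ereal_sup => _ [q _ <-]; rewrite lee_fin.
have mE : measurable E.
  by rewrite EE; exact: (@measurable_depth_event R d dT T P X Xs Lpi d0 hproj n hn eps heps).
split=> //; apply: off_small_prob => //; rewrite EE {EE mE E}.
have [lam0 C10 _] := hdecay; have [Lpi0 _] := hproj; have [Lt0 _] := hrad.
have sl0 : 0 < Num.sqrt lambda by rewrite sqrtr_gt0.
have N0 : 0 < n%:R :> R by rewrite ltr0n.
have slN : 0 < Num.sqrt lambda * (n%:R + 1) by rewrite mulr_gt0 // ltr_wpDl.
pose R0 := 2 * eps * n%:R `^ (3 / 2) / (Num.sqrt lambda * (n%:R + 1)).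
have R01 : 1 < R0 by rewrite /R0 ltr_pdivlMr // mul1r.
have R00 : 0 < R0 by apply: lt_trans R01.
have S0 : 0 < Ltheta + Lpi * R0 by rewrite ltr_wpDl // mulr_gt0.
pose psi := eps / (n%:R + 1) / (Ltheta + Lpi * R0).
have psi0 : 0 < psi by rewrite /psi !divr_gt0 // ltr_wpDl.
have psi1 : psi < acos (Num.sqrt d%:R)^-1.
  rewrite /psi (_ : Lpi * R0 = Lpi * eps *
    (2 * n%:R `^ (3 / 2) / (Num.sqrt lambda * (n%:R + 1)))) //.
  by rewrite /R0; ring.
pose A' := C2 * (Num.sqrt d%:R / psi) ^+ (d - 1) * (d - 1)%:R `^ (3 / 2) * ln d%:R.
have AE : A = 2 * A' by rewrite /A (covering_base _ N0 heps sl0 S0) -/R0 -/psi /A' !mulrA.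
have A'1 : 1 <= A' by exact: covering_size.
have lnA : (d - 1)%:R * (ln d%:R / 2 - ln (8 / 5)) - ln 2 <= ln A.
  by rewrite AE; exact: ln_covering_bound_ge.
have A2 : 2 <= A by rewrite AE; lra.
have A0 : 0 < A by apply: lt_le_trans A2.
have B0 : 0 <= B.
  rewrite /B; apply: mulr_ge0 (powR_ge0 _ _); apply: mulr_ge0 (ltW C10) _.
  by apply: exprn_ge0; apply: divr_ge0 (ltW slN); apply: mulr_ge0; apply: ltW.
set D := (A + B) * expR 4 * expR (- (2 * n%:R * eps ^+ 2)).
have D0 : 0 < D by rewrite /D !mulr_gt0 ?expR_gt0 // ltr_wpDr.
(* If the bound is trivial, everything is exceptional. *)
have [D1|D1] := lerP 1 D.
  exists setT; split; first exact: measurableT.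
    by rewrite probability_setT lee_fin.
  by move=> w /(_ I).
have nontriv : 4 + ln A < 2 * n%:R * eps ^+ 2.
  have : A * expR 4 * expR (- (2 * n%:R * eps ^+ 2)) < 1.
    by apply: le_lt_trans D1; rewrite /D !ler_wpM2r ?expR_ge0 // lerDl.
  rewrite -[X in X * expR 4](lnK (x := A)) ?posrE //.
  by rewrite -!expRD -expR0 ltr_expR subr_lt0 addrC.
(* If eps exceeds all sample depths, the event is almost sure. *)
have [hbig|hsmall] := lerP (2^-1 + (2 * n%:R)^-1) eps.
  exact: (depth_half d0 hindep hid hproj hn hbig D0).
have lnA2 : 1 / 2 <= ln A.
  by apply: le_trans (@ln2_ge R) _; rewrite ler_ln ?posrE.
have neps2 : 9 / 2 < 2 * n%:R * eps ^+ 2 by apply: le_lt_trans nontriv; lra.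
have [n7 eps47] := sample_size_ge7 hn heps hsmall neps2.
have N7 : 7 <= n%:R :> R by rewrite ler_nat.
have [e0 e47] := deviation_range N7 heps eps47 neps2.
(* lambda r^2 / 2 = (25/2) n eps^2 leaves room for the power of 5 (n + 1) / n in the tail. *)
pose r := 5 * eps * Num.sqrt n%:R / Num.sqrt lambda.
have rE : r = 5 / 2 * ((n%:R + 1) / n%:R) * R0 by exact: radius_rescaled.
have r1 : 1 < r.
  have q1 : 1 <= 5 / 2 * ((n%:R + 1) / n%:R) :> R.
    by rewrite mulrA ler_pdivlMr //; lra.
  by rewrite rE; apply: lt_le_trans R01 _; rewrite ler_peMl // ltW.
(* With M = 100 n cells the grid costs 1 / (100 n), small next to the net error. *)
have M0 : (0 < 100 * n)%N by rewrite muln_gt0.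
have [s [ss sA cov]] := hC2.2 d psi hd psi0 psi1.
apply: off_small_sub (depth_deviation d0 hindep hid hdecay hproj hrad hn ss cov
  (ltW psi0) r1 M0 e0 e47); last first.
  move=> w hw q; apply: le_trans (hw q) _.
  have := net_error N0 heps Lt0 Lpi0 R00; rewrite -/psi -rE natrM.
  by move: (psi * _) => z; lra.
rewrite /D (mulrDl A B) (mulrDl (A * _)); apply: lerD; last first.
  exact: tail_budget hd n7 lam0 C10 heps lnA (ltW nontriv).
apply: (@le_trans _ _ (A' * (2 * expR 4 * expR (- (2 * n%:R * eps ^+ 2))))); last first.
  by rewrite le_eqVlt; apply/orP; left; apply/eqP; rewrite AE; ring.
apply: ler_pM; [exact: ler0n| |exact: sA|exact: expR_budget].
by rewrite mulr_ge0 ?expR_ge0.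
Qed.
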